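(* Fix $0<p<2$, $\eta>0$ and $n\ge1$. Then $\bar R_n^*(M_{n,p}(\eta))=\bar\rho_p(\eta)$.
   Context: Minimax-Bayes risk: $\bar R_n^*(M_{n,p}(\eta))=\inf_{\hat\mu}\sup_\pi\{\mathbb{E}_\pi\mathbb{E}_\mu[\frac1n\sum_{i=1}^n(\log\hat\mu_i-\log\mu_i)^2]:\ \mathbb{E}_\pi[\frac1n\sum_{i=1}^n\log^p\mu_i]\le\eta^p\}$, where $\pi$ ranges over distributions on $[1,\infty)^n$, given $\mu$ the data $X_1,\dots,X_n$ are independent with $X_i\sim\mathrm{Exp}(\mu_i)$ (mean $\mu_i$), and $\hat\mu$ ranges over estimators with values in $(0,\infty)^n$. Univariate minimax-Bayes risk: with $\mathcal F_p(\eta)$ the set of distributions $F$ on $[1,\infty)$ with $\int\log^p(\mu)\,dF(\mu)\le\eta^p$, a scalar $\mu\sim F$ and $X\mid\mu\sim\mathrm{Exp}(\mu)$, set $\bar\rho_p(\eta)=\inf_\delta\sup_{F\in\mathcal F_p(\eta)}\mathbb{E}_F\mathbb{E}_\mu(\log\delta(X)-\log\mu)^2$, infimum over measurable $\delta:[0,\infty)\to(0,\infty)$. *)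

(* Defs.v *)
From HB Require Import structures.
From mathcomp Require Import all_boot all_order all_algebra.
From mathcomp Require Import all_classical all_reals all_analysis.
Unset Implicit Arguments. Unset Strict Implicit. Unset Printing Implicit Defensive.
Import Order.TTheory GRing.Theory Num.Theory.
Import numFieldNormedType.Exports.
Local Open Scope classical_set_scope.
Local Open Scope ring_scope.

Section Defs.
Context {R : realType}.
Notation leb := (@lebesgue_measure R).

Definition exp_density (m x : R) : R :=
  if 0 <= x then m^-1 * expR (- (x / m)) else 0.

(* E_mu[g(X)] with X_1..X_n independent, X_i ~ Exp(mean mu_i), written as the
   iterated Lebesgue integral against the product density (g nonnegative). *)
Fixpoint cond_expect (n : nat) : n.-tuple R -> (n.-tuple R -> \bar R) -> \bar R :=
  match n return n.-tuple R -> (n.-tuple R -> \bar R) -> \bar R with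
  | 0 => fun _ g => g [tuple]
  | n'.+1 => fun mu g =>
      (\int[leb]_(x in [set: R])
         ((exp_density (thead mu) x)%:E *
          cond_expect n' (behead_tuple mu) (fun t => g (cons_tuple x t))))%E
  end.

Definition log_loss (n : nat) (est mu : n.-tuple R) : R :=
  n%:R^-1 * \sum_(i < n) (ln (tnth est i) - ln (tnth mu i)) ^+ 2.

Definition estimator (n : nat) (d : n.-tuple R -> n.-tuple R) : Prop :=
  measurable_fun [set: n.-tuple R] d /\ forall x i, 0 < tnth (d x) i.

Definition support_ge1 (n : nat) : set (n.-tuple R) :=
  [set mu | forall i, 1 <= tnth mu i].

Definition prior_class (n : nat) (p eta : R)
    (pi : probability (n.-tuple R) R) : Prop :=
  pi (support_ge1 n) = 1%E /\
  (\int[pi]_(mu in support_ge1 n)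
      (n%:R^-1 * \sum_(i < n) powR (ln (tnth mu i)) p)%:E <= (powR eta p)%:E)%E.

Definition bayes_risk (n : nat) (pi : probability (n.-tuple R) R)
    (d : n.-tuple R -> n.-tuple R) : \bar R :=
  (\int[pi]_(mu in support_ge1 n)
      cond_expect n mu (fun x => (log_loss n (d x) mu)%:E))%E.

Definition minimax_bayes_risk (n : nat) (p eta : R) : \bar R :=
  ereal_inf [set r | exists d, estimator n d /\
     r = ereal_sup [set bayes_risk n pi d | pi in prior_class n p eta]].

Definition univ_estimator (d : R -> R) : Prop :=
  measurable_fun [set: R] d /\ forall x, 0 < d x.

Definition univ_prior_class (p eta : R) (F : probability R R) : Prop :=
  F `[1%R, +oo[%classic = 1%E /\
  (\int[F]_(mu in `[1%R, +oo[) (powR (ln mu) p)%:E <= (powR eta p)%:E)%E.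

Definition univ_bayes_risk (F : probability R R) (d : R -> R) : \bar R :=
  (\int[F]_(mu in `[1%R, +oo[)
     \int[leb]_(x in [set: R])
        ((exp_density mu x)%:E * ((ln (d x) - ln mu) ^+ 2)%:E))%E.

Definition univ_minimax_bayes_risk (p eta : R) : \bar R :=
  ereal_inf [set r | exists d, univ_estimator d /\
     r = ereal_sup [set univ_bayes_risk F d | F in univ_prior_class p eta]].

End Defs.

(* Main.v *)
(* Write g = log delta. The frequentist risk of g at m is quadratic in g, and only
   finitely supported univariate priors matter: a bound S on the Bayes risk of g over
   those gives, by two-point priors, a line S + lam (log^p m - eta^p) above the risk,
   and integrating this line handles every prior, univariate or multivariate. Applied
   to coordinatewise estimators this yields "<=".
   For ">=", an n-dimensional estimator with risk at most W is tested against product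
   priors F^n; freezing the other data, some coordinate is a univariate estimator of
   Bayes risk about W under F. So every F has such an estimator, and a univariate
   minimax theorem exchanges the quantifiers. To prove it, mix each prior with a small
   point mass at 1: the payoff becomes uniformly convex in L^2(exp(-x) dx), hence
   near-Bayes estimators along near least favourable priors form a Cauchy sequence,
   and by Fatou their limit is good against all priors at once. *)
Require Import Defs.
From HB Require Import structures.
From mathcomp Require Import all_boot all_order all_algebra.
From mathcomp Require Import all_classical all_reals all_analysis.
From mathcomp Require Import measurable_realfun ring lra.
Import Order.TTheory GRing.Theory Num.Theory.
Import numFieldNormedType.Exports.
Local Open Scope classical_set_scope.
Local Open Scope ring_scope.

(** * Exponential densities and the univariate risk *)

Section Density.
Context {R : realType}.
Notation leb := (@lebesgue_measure R).

(** The inverse is split into real powers of exponent [-1] of the positive and negative parts. The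
    default values agree at 0: both [0^-1] and [powR 0 (-1)] are 0. *)
Lemma measurable_invr : measurable_fun [set: R] (@GRing.inv R).
Proof.
rewrite (_ : @GRing.inv R = fun x => powR (Num.max x 0) (-1) - powR (Num.max (- x) 0) (-1)).
  apply: measurable_funB.
    apply: (measurableT_comp (measurable_powR _)).
    exact: measurable_maxr.
  apply: (measurableT_comp (measurable_powR _)).
  by apply: measurable_maxr => //; exact: oppr_measurable.
have p0 : powR 0 (-1) = 0 :> R by rewrite powR0// oppr_eq0 oner_eq0.
apply/funext => x; have [x0|x0] := leP 0 x.
  rewrite (max_idPr _) ?oppr_le0// p0 subr0.
  by rewrite powR_inv1.
have nx0 : 0 <= - x by rewrite oppr_ge0 ltW.
by rewrite (max_idPl _)// p0 sub0r powR_inv1// invrN opprK.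
Qed.

Lemma measurable_exp_density {d} {T : measurableType d} (m x : T -> R) :
  measurable_fun setT m -> measurable_fun setT x ->
  measurable_fun setT (fun t => exp_density (m t) (x t)).
Proof.
move=> mm mx; rewrite /exp_density.
have mi : measurable_fun setT (fun t => (m t)^-1).
  exact: (measurableT_comp measurable_invr).
apply: measurable_fun_ifT => //.
  exact: measurable_fun_ler.
apply: measurable_funM => //.
apply: (measurableT_comp (@measurable_expR R)).
by apply: measurable_funN; apply: measurable_funM.
Qed.

Lemma exp_density_ge0 (m x : R) : 0 < m -> 0 <= exp_density m x.
Proof.
move=> m0; rewrite /exp_density; case: ifP => // _.
by rewrite mulr_ge0 ?expR_ge0// invr_ge0 ltW.
Qed.

Lemma integral_exp_density (m : R) : 0 < m ->
  (\int[leb]_(x in [set: R]) (exp_density m x)%:E = 1)%E.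
Proof.
move=> m0; rewrite -(@integral_exponential_pdf R m^-1) ?invr_gt0//.
apply: eq_integral => x _; congr EFin.
rewrite /exp_density; case: ifPn => [x0|]; last first.
  by rewrite -ltNge => x0; rewrite lt0_exponential_pdf.
by rewrite exponential_pdfE// mulNr [_^-1 * x]mulrC.
Qed.

(** The argument [g] is the logarithm of an estimator: positivity disappears and the loss becomes
    quadratic. *)
Definition risk (g : R -> R) (m : R) : \bar R :=
  (\int[leb]_(x in [set: R]) ((exp_density m x)%:E * ((g x - ln m) ^+ 2)%:E))%E.

Lemma measurable_risk_integrand {d} {T : measurableType d} (g m x : T -> R) :
  measurable_fun setT g -> measurable_fun setT m -> measurable_fun setT x ->
  measurable_fun setT
    (fun t => ((exp_density (m t) (x t))%:E * ((g t - ln (m t)) ^+ 2)%:E)%E).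
Proof.
move=> mg mm mx; apply: emeasurable_funM; apply/measurable_EFinP.
  exact: measurable_exp_density.
apply: measurable_funX; apply: measurable_funB => //.
exact: (measurableT_comp (@measurable_ln R)).
Qed.

Lemma measurable_risk {d} {T : measurableType d} (g : T * R -> R) (m : T -> R) :
  measurable_fun setT g -> measurable_fun setT m -> (forall t, 0 < m t) ->
  measurable_fun setT (fun t => risk (fun x => g (t, x)) (m t)).
Proof.
move=> mg mm m0.
apply: (@measurable_fun_fubini_tonelli_F _ _ _ _ _ leb
  (fun z => (exp_density (m z.1) z.2)%:E * ((g z - ln (m z.1)) ^+ 2)%:E)%E).
  apply: (measurable_risk_integrand g (fun z => m z.1) snd) => //.
  exact: (measurableT_comp mm).
by move=> z; rewrite -EFinM lee_fin mulr_ge0 ?sqr_ge0// exp_density_ge0.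
Qed.

Lemma risk_ge0 (g : R -> R) (m : R) : 0 < m -> (0 <= risk g m)%E.
Proof.
move=> m0; apply: integral_ge0 => x _.
by rewrite -EFinM lee_fin mulr_ge0 ?sqr_ge0// exp_density_ge0.
Qed.

(** A finitely supported prior is a list of pairs (weight, mean), possibly with repetitions. *)
Definition bayes (F : seq (R * R)) (g : R -> R) : \bar R :=
  (\sum_(q <- F) q.1%:E * risk g q.2)%E.

End Density.

(** * Finitely supported priors *)

Section FinitePriors.
Context {R : realType}.

(** The measure is a sum of weighted Dirac masses. Only its integrals are recorded, over domains [D]
    containing the atoms, because risks are known to be measurable and nonnegative only on such
    domains. *)
Lemma finite_measure_of_seq d (T : measurableType d) (F : seq (R * T)) :
  (forall q, q \in F -> 0 <= q.1) ->
  exists mu : {measure set T -> \bar R}, forall (D : set T) (f : T -> \bar R),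
    measurable D -> measurable_fun D f -> (forall x, D x -> (0 <= f x)%E) ->
    (forall q, q \in F -> D q.2) ->
    (\int[mu]_(x in D) f x = \sum_(q <- F) q.1%:E * f q.2)%E.
Proof.
elim: F => [|[w a] F IH] w0.
  exists mzero => D f mD mf f0 _.
  by rewrite big_nil integral_measure_zero.
have [q qF|mu IHmu] := IH; first by apply: w0; rewrite inE qF orbT.
have w0' : 0 <= w by apply: (w0 (w, a)); rewrite mem_head.
exists (measure_add (mscale (NngNum w0') (dirac a)) mu) => D f mD mf f0 FD.
rewrite ge0_integral_measure_add// ge0_integral_mscale// integral_dirac//.
rewrite big_cons IHmu//; last by move=> q qF; apply: FD; rewrite inE qF orbT.
rewrite diracE mem_set ?mul1e//.
by apply: (FD (w, a)); rewrite mem_head.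
Qed.

Lemma finite_prior d (T : measurableType d) (F : seq (R * T)) :
  (forall q, q \in F -> 0 <= q.1) -> \sum_(q <- F) q.1 = 1 ->
  exists pi : probability T R, forall (D : set T) (f : T -> \bar R),
    measurable D -> measurable_fun D f -> (forall x, D x -> (0 <= f x)%E) ->
    (forall q, q \in F -> D q.2) ->
    (\int[pi]_(x in D) f x = \sum_(q <- F) q.1%:E * f q.2)%E.
Proof.
move=> w0 w1; have [mu Hmu] := finite_measure_of_seq _ T F w0.
have muT : mu setT = 1%E.
  rewrite -[LHS]mul1e -integral_cst// Hmu//.
  by under eq_bigr do rewrite mule1; rewrite sumEFin w1.
have : exists q, q \in F.
  case: F w1 {w0 Hmu} => [|q F] w1; last by exists q; rewrite mem_head.
  by move: w1; rewrite big_nil => /eqP; rewrite eq_sym oner_eq0.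
(* Normalization serves only to obtain the type of probabilities: the mass is already 1, and the
   Dirac mass is the fallback value that [mnormalize] takes. *)
move=> [q _]; exists (mnormalize mu (dirac q.2)) => D f mD mf f0 FD.
rewrite -(Hmu D f)//; apply: eq_measure_integral => A mA _.
by rewrite /= /mnormalize muT onee_eq0/= invr1 mule1.
Qed.

Lemma finite_prior_set d (T : measurableType d) (F : seq (R * T))
    (pi : probability T R) (D : set T) :
  \sum_(q <- F) q.1 = 1 -> measurable D -> (forall q, q \in F -> D q.2) ->
  (forall (D : set T) (f : T -> \bar R),
    measurable D -> measurable_fun D f -> (forall x, D x -> (0 <= f x)%E) ->
    (forall q, q \in F -> D q.2) ->
    (\int[pi]_(x in D) f x = \sum_(q <- F) q.1%:E * f q.2)%E) ->
  pi D = 1%E.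
Proof.
move=> w1 mD FD H; rewrite -[LHS]mul1e -integral_cst// H//.
by under eq_bigr do rewrite mule1; rewrite sumEFin w1.
Qed.

(** Weak duality: integrating the bound and inserting the moment constraint leaves the finite term
    [lam * c] on both sides, where it cancels. The additive form avoids subtraction in the extended
    reals. *)
Lemma prior_integral_le d (T : measurableType d) (pi : probability T R) (D : set T)
    (rho : T -> \bar R) (a : T -> R) (S lam c : R) :
  measurable D -> pi D = 1%E -> measurable_fun D rho -> measurable_fun D a ->
  (forall x, D x -> (0 <= rho x)%E) -> (forall x, D x -> 0 <= a x) ->
  0 <= S -> 0 <= lam -> 0 <= c ->
  (\int[pi]_(x in D) (a x)%:E <= c%:E)%E ->
  (forall x, D x -> (rho x + (lam * c)%:E <= (S + lam * a x)%:E)%E) ->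
  (\int[pi]_(x in D) rho x <= S%:E)%E.
Proof.
move=> mD piD mrho ma rho0 a0 S0 lam0 c0 ac H.
have cst0 k : (\int[pi]_(x in D) (cst k%:E) x = k%:E)%E.
  rewrite integral_cst//; transitivity (k%:E * 1)%E; last exact: mule1.
  by congr (_ * _)%E; exact: piD.
have mla : measurable_fun D (fun x => (lam * a x)%:E).
  by apply/measurable_EFinP; apply: measurable_funM.
have : (\int[pi]_(x in D) (rho x + (lam * c)%:E) <= \int[pi]_(x in D) (S + lam * a x)%:E)%E.
  apply: ge0_le_integral => //.
  - by move=> x Dx; rewrite adde_ge0 ?rho0// lee_fin mulr_ge0.
  - by apply: emeasurable_funD.
  - by apply/measurable_EFinP; apply: measurable_funD => //; apply: measurable_funM.
rewrite ge0_integralD//; last by move=> x _; rewrite lee_fin mulr_ge0.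
under [X in (_ <= X)%E -> _]eq_integral do rewrite EFinD.
rewrite ge0_integralD//; last by move=> x Dx; rewrite lee_fin mulr_ge0 ?a0.
rewrite (cst0 (lam * c)) (cst0 S).
under [X in (_ <= _ + X)%E -> _]eq_integral do rewrite EFinM.
rewrite ge0_integralZl_EFin//; last exact/measurable_EFinP.
move=> le1; rewrite -(leeD2rE (x := (lam * c)%:E))//.
by apply: (le_trans le1); rewrite leeD2l// EFinM lee_wpmul2l.
Qed.

End FinitePriors.

(** * Iterated integrals against the data *)

Section CondExpect.
Context {R : realType}.
Notation leb := (@lebesgue_measure R).
Implicit Types (n : nat) (m : R).

Lemma cond_expect_cons n m (mu : n.-tuple R) (g : n.+1.-tuple R -> \bar R) :
  cond_expect n.+1 (cons_tuple m mu) g =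
  (\int[leb]_(x in [set: R]) ((exp_density m x)%:E *
     cond_expect n mu (fun t => g (cons_tuple x t))))%E.
Proof.
rewrite /=; apply: eq_integral => x _; rewrite theadE; congr (_ * _)%E.
by congr (cond_expect n _ _); apply/val_inj.
Qed.

Lemma measurable_cons_tuple d (T : measurableType d) n (f : T -> R) (g : T -> n.-tuple R) :
  measurable_fun setT f -> measurable_fun setT g ->
  measurable_fun setT (fun t => cons_tuple (f t) (g t)).
Proof. exact: measurable_cons. Qed.

Lemma cond_expect_ge0 n (mu : n.-tuple R) (g : n.-tuple R -> \bar R) :
  (forall i, 0 < tnth mu i) -> (forall x, (0 <= g x)%E) ->
  (0 <= cond_expect n mu g)%E.
Proof.
elim: n mu g => [|n IH] mu g mu0 g0; first exact: g0.
case/tupleP: mu mu0 => m mu mu0; rewrite cond_expect_cons.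
apply: integral_ge0 => x _; apply: mule_ge0.
  by rewrite lee_fin exp_density_ge0//; have := mu0 ord0; rewrite tnth0.
apply: IH => // i; have := mu0 (lift ord0 i).
by rewrite tnthS.
Qed.

(** The parameter space [T] is arbitrary because the induction enlarges it: the coordinate being
    integrated joins the parameter, and Tonelli applies on [T * R]. *)
Lemma measurable_cond_expect {d} {T : measurableType d} n (mu : T -> n.-tuple R)
    (phi : T * n.-tuple R -> \bar R) :
  measurable_fun setT mu -> measurable_fun setT phi ->
  (forall t i, 0 < tnth (mu t) i) -> (forall z, (0 <= phi z)%E) ->
  measurable_fun setT (fun t => cond_expect n (mu t) (fun x => phi (t, x))).
Proof.
elim: n d T mu phi => [|n IH] d T mu phi mmu mphi mu0 phi0.
  by apply: (measurableT_comp mphi); exact: measurable_fun_pair.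
have mt i : measurable_fun setT (fun t => tnth (mu t) i).
  by have /measurable_fun_tnthP := mmu; exact.
have mhead : measurable_fun setT (fun t => thead (mu t)) by exact: mt.
have mbeh : measurable_fun setT (fun t => behead_tuple (mu t)).
  apply/measurable_fun_tnthP => i.
  rewrite (_ : _ \o _ = fun t => tnth (mu t) (lift ord0 i)).
    exact: mt.
  apply/funext => t /=; rewrite tnth_behead; congr tnth; apply/val_inj => /=.
  by rewrite inordK// ltnS; exact: (ltn_ord i).
pose f (z : T * R) := ((exp_density (thead (mu z.1)) z.2)%:E *
  cond_expect n (behead_tuple (mu z.1)) (fun s => phi (z.1, cons_tuple z.2 s)))%E.
have beh0 t i : 0 < tnth (behead_tuple (mu t)) i by rewrite tnth_behead.
apply: (@measurable_fun_fubini_tonelli_F _ _ _ _ _ leb f).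
- apply: emeasurable_funM.
    apply/measurable_EFinP; apply: measurable_exp_density => //.
    exact: (measurableT_comp mhead).
  pose phi' (w : (T * R) * n.-tuple R) := phi (w.1.1, cons_tuple w.1.2 w.2).
  apply: (IH _ _ (fun z => behead_tuple (mu z.1)) phi') => //.
  + exact: (measurableT_comp mbeh).
  + apply: (measurableT_comp mphi); apply: measurable_fun_pair.
      exact: (measurableT_comp measurable_fst).
    apply: measurable_cons_tuple => //.
    exact: (measurableT_comp measurable_snd).
  + by move=> z; exact: phi0.
- move=> z; apply: mule_ge0; first by rewrite lee_fin exp_density_ge0//; exact: (mu0 z.1 ord0).
  exact: cond_expect_ge0.
Qed.

Lemma measurable_cond_expect_cons n (mu : n.-tuple R) (h : n.+1.-tuple R -> \bar R) :
  (forall i, 0 < tnth mu i) -> measurable_fun setT h -> (forall x, (0 <= h x)%E) ->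
  measurable_fun setT (fun x : R => cond_expect n mu (fun t => h (cons_tuple x t))).
Proof.
move=> mu0 mh h0.
apply: (measurable_cond_expect n (fun=> mu) (fun z => h (cons_tuple z.1 z.2))) => //.
by apply: (measurableT_comp mh); exact: measurable_cons_tuple.
Qed.

Lemma tuple_gt0_cons n m (mu : n.-tuple R) :
  (forall i, 0 < tnth (cons_tuple m mu) i) -> 0 < m /\ forall i, 0 < tnth mu i.
Proof.
move=> mu0; split; first by have := mu0 ord0; rewrite tnth0.
by move=> i; have := mu0 (lift ord0 i); rewrite tnthS.
Qed.

Lemma integral_exp_densityZ m (c : \bar R) : 0 < m -> (0 <= c)%E ->
  (\int[leb]_(x in [set: R]) ((exp_density m x)%:E * c) = c)%E.
Proof.
move=> m0 c0; rewrite ge0_integralZr//.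
- by rewrite integral_exp_density// mul1e.
- by apply/measurable_EFinP; exact: measurable_exp_density.
- by move=> x _; rewrite lee_fin exp_density_ge0.
Qed.

Lemma cond_expect_cst n (mu : n.-tuple R) (c : \bar R) :
  (forall i, 0 < tnth mu i) -> (0 <= c)%E -> cond_expect n mu (fun=> c) = c.
Proof.
elim: n mu => [//|n IH] mu; case/tupleP: mu => m mu /tuple_gt0_cons[m0 mu0] c0.
rewrite cond_expect_cons; under eq_integral do rewrite IH//.
exact: integral_exp_densityZ.
Qed.

Lemma le_cond_expect n (mu : n.-tuple R) (g h : n.-tuple R -> \bar R) :
  (forall i, 0 < tnth mu i) -> measurable_fun setT g -> measurable_fun setT h ->
  (forall x, (0 <= g x)%E) -> (forall x, (g x <= h x)%E) ->
  (cond_expect n mu g <= cond_expect n mu h)%E.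
Proof.
elim: n mu g h => [|n IH] mu g h; first by move=> _ _ _ _; exact.
case/tupleP: mu => m mu /tuple_gt0_cons[m0 mu0] mg mh g0 gh.
have h0 x : (0 <= h x)%E by exact: le_trans (gh x).
have mdens : measurable_fun setT (fun x => (exp_density m x)%:E).
  by apply/measurable_EFinP; exact: measurable_exp_density.
rewrite !cond_expect_cons; apply: ge0_le_integral => //.
- move=> x _; apply: mule_ge0; first by rewrite lee_fin exp_density_ge0.
  exact: cond_expect_ge0.
- by apply: emeasurable_funM => //; exact: measurable_cond_expect_cons.
- by apply: emeasurable_funM => //; exact: measurable_cond_expect_cons.
- move=> x _; apply: lee_wpmul2l; first by rewrite lee_fin exp_density_ge0.
  apply: IH => //.
  + by apply: (measurableT_comp mg); exact: measurable_cons_tuple.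
  + by apply: (measurableT_comp mh); exact: measurable_cons_tuple.
Qed.

Lemma emeasurable_sum_in d (T : measurableType d) (I : eqType) (s : seq I)
    (f : I -> T -> \bar R) :
  (forall i, i \in s -> measurable_fun setT (f i)) ->
  measurable_fun setT (fun x => \sum_(i <- s) f i x)%E.
Proof.
move=> mf; under eq_fun do rewrite big_tnth.
by apply: emeasurable_sum => i; apply: mf; exact: mem_tnth.
Qed.

Lemma exp_density_sum m (I : eqType) (s : seq I) (w : I -> R) (h : I -> R -> \bar R) :
  0 < m -> (forall i, i \in s -> 0 <= w i) ->
  (forall i, i \in s -> measurable_fun setT (h i)) ->
  (forall i x, i \in s -> (0 <= h i x)%E) ->
  (\int[leb]_(x in [set: R]) ((exp_density m x)%:E * \sum_(i <- s) (w i)%:E * h i x) =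
  \sum_(i <- s) (w i)%:E * \int[leb]_(x in [set: R]) ((exp_density m x)%:E * h i x))%E.
Proof.
move=> m0 w0 mh h0.
have d0 x : (0 <= (exp_density m x)%:E)%E by rewrite lee_fin exp_density_ge0.
have mi i : i \in s -> measurable_fun setT (fun x => (exp_density m x)%:E * h i x)%E.
  move=> si; apply: emeasurable_funM; last exact: mh.
  by apply/measurable_EFinP; exact: measurable_exp_density.
(* Summing over positions in [s] makes the membership hypotheses available for every index. *)
transitivity (\int[leb]_(x in [set: R]) \sum_(i < size s)
    (w (tnth (in_tuple s) i))%:E * ((exp_density m x)%:E * h (tnth (in_tuple s) i) x))%E.
  apply: eq_integral => x _; rewrite big_tnth ge0_sume_distrr.
    by apply: eq_bigr => i _; rewrite muleCA.
  move=> i _; apply: mule_ge0; first by rewrite lee_fin w0// mem_tnth.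
  by rewrite h0// mem_tnth.
rewrite [RHS]big_tnth ge0_integral_sum//.
- apply: eq_bigr => i _; rewrite ge0_integralZl_EFin//.
  + by move=> x _; apply: mule_ge0 => //; rewrite h0// mem_tnth.
  + by apply: mi; exact: mem_tnth.
  + by rewrite w0// mem_tnth.
- move=> i; apply: (@measurable_funeM _ _ R setT _ (w (tnth (in_tuple s) i))%:E).
  by apply: mi; exact: mem_tnth.
- move=> i x _; apply: mule_ge0; first by rewrite lee_fin w0// mem_tnth.
  by apply: mule_ge0 => //; rewrite h0// mem_tnth.
Qed.

Lemma cond_expect_sum n (mu : n.-tuple R) (I : eqType) (s : seq I) (w : I -> R)
    (h : I -> n.-tuple R -> \bar R) :
  (forall i, 0 < tnth mu i) -> (forall i, i \in s -> measurable_fun setT (h i)) ->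
  (forall i x, i \in s -> (0 <= h i x)%E) -> (forall i, i \in s -> 0 <= w i) ->
  (cond_expect n mu (fun x => \sum_(i <- s) (w i)%:E * h i x) =
  \sum_(i <- s) (w i)%:E * cond_expect n mu (h i))%E.
Proof.
elim: n mu h => [//|n IH] mu h.
case/tupleP: mu => m mu /tuple_gt0_cons[m0 mu0] mh h0 w0.
rewrite cond_expect_cons.
transitivity (\int[leb]_(x in [set: R]) ((exp_density m x)%:E * \sum_(i <- s) (w i)%:E *
    cond_expect n mu (fun t => h i (cons_tuple x t))))%E.
  apply: eq_integral => x _; rewrite IH//; last by move=> *; exact: h0.
  by move=> i si; apply: (measurableT_comp (mh i si)); exact: measurable_cons_tuple.
rewrite exp_density_sum//.
- by apply: eq_bigr => i _; rewrite cond_expect_cons.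
- by move=> i si; apply: measurable_cond_expect_cons => //; [exact: mh|move=> x; exact: h0].
- by move=> i x si; apply: cond_expect_ge0 => // t; exact: h0.
Qed.

(** The densities of all other coordinates integrate to one. *)
Lemma cond_expect_tnth n (mu : n.-tuple R) (i : 'I_n) (h : R -> \bar R) :
  (forall i, 0 < tnth mu i) -> measurable_fun setT h -> (forall x, (0 <= h x)%E) ->
  cond_expect n mu (fun x => h (tnth x i)) =
  (\int[leb]_(x in [set: R]) ((exp_density (tnth mu i) x)%:E * h x))%E.
Proof.
elim: n mu i => [|n IH] mu i; first by case: i.
case/tupleP: mu => m mu /tuple_gt0_cons[m0 mu0] mh h0.
rewrite cond_expect_cons; case: (unliftP ord0 i) => [j|] ->.
  under eq_integral => x _.
    rewrite (_ : (fun t => _) = fun t => h (tnth t j)); last first.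
      by apply/funext => t; rewrite tnthS.
    rewrite IH//.
    over.
  rewrite tnthS integral_exp_densityZ//.
  apply: integral_ge0 => x _; apply: mule_ge0 => //.
  by rewrite lee_fin exp_density_ge0.
rewrite tnth0; apply: eq_integral => x _; congr (_ * _)%E.
by rewrite -[RHS](cond_expect_cst n mu)//; congr cond_expect.
Qed.

Lemma exp_density_swap (m m' : R) (C : R * R -> \bar R) :
  0 < m -> 0 < m' -> measurable_fun setT C -> (forall z, (0 <= C z)%E) ->
  (\int[leb]_(x in [set: R]) ((exp_density m x)%:E *
      \int[leb]_(y in [set: R]) ((exp_density m' y)%:E * C (x, y))) =
   \int[leb]_(y in [set: R]) ((exp_density m' y)%:E *
      \int[leb]_(x in [set: R]) ((exp_density m x)%:E * C (x, y))))%E.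
Proof.
move=> m0 m'0 mC C0.
have d0 (a x : R) : 0 < a -> (0 <= (exp_density a x)%:E)%E.
  by move=> ?; rewrite lee_fin exp_density_ge0.
have mdens d (T : measurableType d) (a : R) (f : T -> R) :
    measurable_fun setT f -> measurable_fun setT (fun x => (exp_density a (f x))%:E).
  by move=> mf; apply/measurable_EFinP; exact: measurable_exp_density.
have mC1 x : measurable_fun [set: R] (fun y => C (x, y)).
  by apply: (measurableT_comp mC); exact: measurable_fun_pair.
have mC2 y : measurable_fun [set: R] (fun x => C (x, y)).
  by apply: (measurableT_comp mC); exact: measurable_fun_pair.
pose f (z : R * R) := ((exp_density m z.1)%:E * ((exp_density m' z.2)%:E * C z))%E.
have f0 z : (0 <= f z)%E by rewrite /f; do 2 (apply: mule_ge0; first exact: d0).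
have mf : measurable_fun setT f.
  by rewrite /f; do 2 (apply: emeasurable_funM; first exact: mdens).
transitivity (\int[leb]_x \int[leb]_y f (x, y))%E.
  apply: eq_integral => x _; rewrite -ge0_integralZl_EFin//.
  - by move=> y _; apply: mule_ge0; [exact: d0|exact: C0].
  - by apply: emeasurable_funM; [exact: mdens|exact: (mC1 x)].
  - by rewrite exp_density_ge0.
rewrite (@fubini_tonelli _ _ _ _ _ leb leb f)//; apply: eq_integral => y _.
transitivity (\int[leb]_x ((exp_density m' y)%:E * ((exp_density m x)%:E * C (x, y))))%E.
  by apply: eq_integral => x _; rewrite /f /= muleCA.
apply: ge0_integralZl_EFin => //.
- by move=> x _; apply: mule_ge0; [exact: d0|exact: C0].
- by apply: emeasurable_funM; [exact: mdens|exact: (mC2 y)].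
- by rewrite exp_density_ge0.
Qed.

(** One use of Tonelli per coordinate. This brings the integral over a chosen datum inside, with the
    other data frozen. *)
Lemma cond_expect_swap n (mu : n.-tuple R) m (phi : R * n.-tuple R -> \bar R) :
  (forall i, 0 < tnth mu i) -> 0 < m -> measurable_fun setT phi ->
  (forall z, (0 <= phi z)%E) ->
  (\int[leb]_(x in [set: R])
     ((exp_density m x)%:E * cond_expect n mu (fun t => phi (x, t))) =
  cond_expect n mu (fun t =>
     \int[leb]_(x in [set: R]) ((exp_density m x)%:E * phi (x, t))))%E.
Proof.
elim: n mu phi => [//|n IH] mu phi.
case/tupleP: mu => m' mu /tuple_gt0_cons[m'0 mu0] m0 mphi phi0.
under eq_integral do rewrite cond_expect_cons.
rewrite (exp_density_swap m m'
  (fun z => cond_expect n mu (fun t => phi (z.1, cons_tuple z.2 t))))//.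
- rewrite cond_expect_cons; apply: eq_integral => y _; congr (_ * _)%E.
  rewrite -(IH mu (fun z => phi (z.1, cons_tuple y z.2)))//.
  apply: (measurableT_comp mphi); apply: measurable_fun_pair => //.
  exact: measurable_cons_tuple.
- apply: (measurable_cond_expect n (fun=> mu)
    (fun w : (R * R) * n.-tuple R => phi (w.1.1, cons_tuple w.1.2 w.2))) => //.
  apply: (measurableT_comp mphi); apply: measurable_fun_pair.
    exact: (measurableT_comp measurable_fst).
  apply: measurable_cons_tuple => //.
  exact: (measurableT_comp measurable_snd).
- by move=> z; exact: cond_expect_ge0.
Qed.

End CondExpect.

(** * Product priors *)

Section ProductPrior.
Context {R : realType}.
Notation leb := (@lebesgue_measure R).

Fixpoint product_prior (F : seq (R * R)) (n : nat) : seq (R * n.-tuple R) :=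
  if n is n'.+1 then
    [seq (q.1 * z.1, cons_tuple q.2 z.2) | q <- F, z <- product_prior F n']
  else [:: (1, [tuple])].

Lemma big_product_prior (V : nmodType) F n (f : R * n.+1.-tuple R -> V) :
  \sum_(z <- product_prior F n.+1) f z =
  \sum_(q <- F) \sum_(z <- product_prior F n) f (q.1 * z.1, cons_tuple q.2 z.2).
Proof. by rewrite /= big_allpairs_dep. Qed.

Lemma product_prior_ge0 F n : (forall q, q \in F -> 0 <= q.1) ->
  forall z, z \in product_prior F n -> 0 <= z.1.
Proof.
move=> F0; elim: n => [|n IH] z /=.
  by rewrite inE => /eqP ->.
by move=> /allpairsP[[q z'] [/= /F0 q0 /IH z0 ->]] /=; rewrite mulr_ge0.
Qed.

Lemma product_prior_sum1 F n : \sum_(q <- F) q.1 = 1 ->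
  \sum_(z <- product_prior F n) z.1 = 1.
Proof.
move=> F1; elim: n => [|n IH]; first by rewrite /= big_seq1.
rewrite big_product_prior /=.
by under eq_bigr do rewrite -mulr_sumr IH mulr1.
Qed.

Lemma product_prior_all (P : R -> Prop) F n : (forall q, q \in F -> P q.2) ->
  forall z, z \in product_prior F n -> forall i, P (tnth z.2 i).
Proof.
move=> FP; elim: n => [|n IH] z /=; first by move=> _ [].
move=> /allpairsP[[q z'] [/= /FP Pq /IH Pz ->]] /= i.
by case: (unliftP ord0 i) => [j|] ->; rewrite ?tnthS ?tnth0.
Qed.

(** The weights of the other coordinates sum to one. With [a] the log moment, this places the
    product prior in the multivariate class. *)
Lemma product_prior_marginal F n (a : R -> R) (i : 'I_n) : \sum_(q <- F) q.1 = 1 ->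
  \sum_(z <- product_prior F n) z.1 * a (tnth z.2 i) = \sum_(q <- F) q.1 * a q.2.
Proof.
move=> F1; elim: n i => [[]//|n IH] i.
rewrite big_product_prior; case: (unliftP ord0 i) => [j|] ->.
  under eq_bigr => q _.
    under eq_bigr => z _ do rewrite tnthS /= -mulrA.
    rewrite -mulr_sumr IH.
    over.
  by rewrite -mulr_suml F1 mul1r.
apply: eq_bigr => q _.
under eq_bigr => z _ do rewrite tnth0 /= mulrAC.
by rewrite -mulr_sumr product_prior_sum1// mulr1.
Qed.

Lemma sum_prior_cst (T : eqType) (L : seq (R * T)) (c : \bar R) :
  (forall q, q \in L -> 0 <= q.1) -> \sum_(q <- L) q.1 = 1 ->
  (\sum_(q <- L) q.1%:E * c = c)%E.
Proof.
move=> L0 L1; rewrite big_seq -ge0_sume_distrl; last by move=> q /L0; rewrite lee_fin.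
by rewrite -big_seq sumEFin L1 mul1e.
Qed.

Lemma le_sum_prior (T : eqType) (L : seq (R * T)) (f : R * T -> \bar R) (c : \bar R) :
  (forall q, q \in L -> 0 <= q.1) -> \sum_(q <- L) q.1 = 1 ->
  (forall q, q \in L -> (c <= f q)%E) -> (c <= \sum_(q <- L) q.1%:E * f q)%E.
Proof.
move=> L0 L1 cf; rewrite -[X in (X <= _)%E](sum_prior_cst _ _ c L0 L1).
rewrite big_seq [in leRHS]big_seq; apply: lee_sum => q qL.
by apply: lee_wpmul2l; [rewrite lee_fin L0|exact: cf].
Qed.

(* Every coordinate of an estimator of n means, with the other data frozen, is an
   estimator of one mean; averaging over these data cannot beat the Bayes risk. *)
Lemma product_prior_risk_ge F n (c : R) (i : 'I_n) (h : n.-tuple R -> R) :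
  (forall q, q \in F -> 0 <= q.1) -> (forall q, q \in F -> 0 < q.2) ->
  \sum_(q <- F) q.1 = 1 -> 0 <= c ->
  (forall g : R -> R, measurable_fun setT g -> (c%:E <= bayes F g)%E) ->
  measurable_fun setT h ->
  (c%:E <= \sum_(z <- product_prior F n) z.1%:E *
     cond_expect n z.2 (fun x => ((h x - ln (tnth z.2 i)) ^+ 2)%:E))%E.
Proof.
move=> F0 Fpos F1 c0 cF; elim: n i h => [[]//|n IH] i h mh.
have z0 := product_prior_ge0 F n F0.
have z1 := product_prior_sum1 F n F1.
have zpos := product_prior_all (fun m => 0 < m) F n Fpos.
have mloss k (g : k.-tuple R -> R) (a : R) : measurable_fun setT g ->
    measurable_fun setT (fun x => ((g x - a) ^+ 2)%:E).
  by move=> mg; apply/measurable_EFinP; apply: measurable_funX; exact: measurable_funB.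
have loss0 k (g : k.-tuple R -> R) (a : R) x : (0 <= ((g x - a) ^+ 2)%:E)%E.
  by rewrite lee_fin sqr_ge0.
have mcons (x : R) : measurable_fun setT (fun t : n.-tuple R => h (cons_tuple x t)).
  by apply: (measurableT_comp mh); exact: measurable_cons_tuple.
pose L := product_prior F n.
rewrite big_product_prior; case: (unliftP ord0 i) => [j|] ->.
(* Coordinate in the tail: for a frozen first datum [x], the induction hypothesis bounds the average
   over the tail, and integrating in [x] preserves the constant bound. *)
- pose CE (z : R * n.-tuple R) x := cond_expect n z.2
    (fun t => ((h (cons_tuple x t) - ln (tnth z.2 j)) ^+ 2)%:E).
  have mCE z : z \in L -> measurable_fun setT (CE z).
    move=> zL; apply: (measurable_cond_expect_cons n z.2
      (fun x => ((h x - ln (tnth z.2 j)) ^+ 2)%:E)) => //; last exact: mloss.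
    exact: zpos.
  have CE0 z x : z \in L -> (0 <= CE z x)%E.
    by move=> zL; apply: cond_expect_ge0 => //; exact: zpos.
  rewrite [leRHS](_ : _ = \sum_(q <- F) q.1%:E *
    \int[leb]_(x in [set: R]) ((exp_density q.2 x)%:E *
      \sum_(z <- L) z.1%:E * CE z x))%E.
    apply: le_sum_prior => // q qF.
    have d0 x : (0 <= (exp_density q.2 x)%:E)%E by rewrite lee_fin exp_density_ge0// Fpos.
    have md : measurable_fun setT (fun x => (exp_density q.2 x)%:E).
      by apply/measurable_EFinP; exact: measurable_exp_density.
    rewrite -(integral_exp_densityZ q.2 c%:E)//; last by apply: Fpos.
    apply: ge0_le_integral => //.
    + by move=> x _; apply: mule_ge0.
    + exact: emeasurable_funM.
    + apply: emeasurable_funM => //.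
      apply: emeasurable_sum_in => z zL.
      by apply: (@measurable_funeM _ _ R setT _ z.1%:E); exact: mCE.
    + by move=> x _; apply: lee_wpmul2l => //; exact: IH.
  rewrite big_seq [RHS]big_seq; apply: eq_bigr => q qF.
  rewrite exp_density_sum//; last exact: Fpos.
  rewrite [in RHS]big_seq ge0_sume_distrr; last first.
    move=> z zL; apply: mule_ge0; first by rewrite lee_fin z0.
    apply: integral_ge0 => x _; apply: mule_ge0; last exact: CE0.
    by rewrite lee_fin exp_density_ge0// Fpos.
  rewrite -big_seq; apply: eq_bigr => z _.
  rewrite cond_expect_cons EFinM -muleA; congr (_ * (_ * _))%E.
  by apply: eq_integral => x _; rewrite /CE tnthS.
(* First coordinate: the tail means and then the tail data [t] are moved outside. What remains
   inside is the Bayes risk under [F] of the estimator with [t] frozen. *)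
- rewrite exchange_big.
  have mg t : measurable_fun setT (fun x => h (cons_tuple x t)).
    by apply: (measurableT_comp mh); exact: measurable_cons_tuple.
  have mrisk q : q \in F ->
      measurable_fun setT (fun t : n.-tuple R => risk (fun x => h (cons_tuple x t)) q.2).
    move=> qF; apply: (measurable_risk (fun z => h (cons_tuple z.2 z.1)) (fun=> q.2)) => //.
      by apply: (measurableT_comp mh); exact: measurable_cons_tuple.
    by move=> _; exact: Fpos.
  rewrite [leRHS](_ : _ = \sum_(z <- L) z.1%:E *
      cond_expect n z.2 (fun t => bayes F (fun x => h (cons_tuple x t))))%E.
    apply: le_sum_prior => // z zL; rewrite -{1}(cond_expect_cst n z.2 c%:E)//; last exact: zpos.
    apply: le_cond_expect => //.
    + exact: zpos.
    + apply: emeasurable_sum_in => q qF.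
      by apply: (@measurable_funeM _ _ R setT _ q.1%:E); exact: mrisk.
    + by move=> t; exact: cF.
  rewrite big_seq [RHS]big_seq; apply: eq_bigr => z zL.
  rewrite /bayes cond_expect_sum//; [|exact: zpos|
    by move=> q t qF; apply: risk_ge0; exact: Fpos].
  rewrite big_seq [in RHS]big_seq ge0_sume_distrr; last first.
    move=> q qF; apply: mule_ge0; first by rewrite lee_fin F0.
    by apply: cond_expect_ge0 => [|t]; [exact: zpos|apply: risk_ge0; exact: Fpos].
  apply: eq_bigr => q qF; rewrite cond_expect_cons tnth0 EFinM -muleA muleCA.
  congr (_ * (_ * _))%E.
  apply: (cond_expect_swap n z.2 q.2
    (fun w => ((h (cons_tuple w.1 w.2) - ln q.2) ^+ 2)%:E)) => //.
  + exact: zpos.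
  + exact: Fpos.
  + apply/measurable_EFinP; apply: measurable_funX; apply: measurable_funB => //.
    by apply: (measurableT_comp mh); exact: measurable_cons_tuple.
Qed.

End ProductPrior.

(** * Minimax theorem *)

Section Minimax.
Context {R : realType}.

(** Both weights are positive, so one infinite term would make the combination infinite. This is the
    passage from extended risks to real arithmetic. *)
Lemma ereal_convex_le (t r : R) (x y : \bar R) :
  0 < t -> t < 1 -> (0 <= x)%E -> (0 <= y)%E ->
  ((1 - t)%:E * x + t%:E * y <= r%:E)%E ->
  exists a b : R, [/\ x = a%:E, y = b%:E, 0 <= a, 0 <= b & (1 - t) * a + t * b <= r].
Proof.
move=> t0 t1; have t10 : 0 < 1 - t by rewrite subr_gt0.
case: x => [a| |]//; case: y => [b| |]//.
- by rewrite !lee_fin => a0 b0 H; exists a, b.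
- by move=> _ _; rewrite gt0_muley ?lte_fin// addey//.
- by move=> _ _; rewrite gt0_muley ?lte_fin// addye// -EFinM.
- by move=> _ _; rewrite !gt0_muley ?lte_fin.
Qed.

(** An abstract game: [P] is the payoff of a prior against an estimator, [D] the convexity gain at a
    midpoint, [W] a bound on best replies, and [t] the sizes of the perturbations. *)
Context {T G : Type} (P : T -> G -> \bar R) (D : G -> G -> \bar R) (W : R) (t : nat -> R).
Hypothesis T0 : inhabited T.
Hypothesis P0 : forall F g, (0 <= P F g)%E.
Hypothesis D0 : forall g h, (0 <= D g h)%E.
Hypothesis P_mix : forall F F' r, 0 < r -> r < 1 ->
  exists F'', forall g, P F'' g = ((1 - r)%:E * P F g + r%:E * P F' g)%E.
Hypothesis P_mid : forall F g h a b, (P F g <= a%:E)%E -> (P F h <= b%:E)%E ->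
  exists m, (P F m + D g h <= ((a + b) / 2)%:E)%E.
Hypothesis P_le : forall F, exists g, (P F g <= W%:E)%E.
Hypothesis t_gt0 : forall k, 0 < t k.
Hypothesis t_le : forall k, t k <= 2^-1.

(* [F k] is nearly least favourable. Moving it by [t k] towards an arbitrary [F] and taking
   a near-best reply [h]: concavity makes [h] good against [F], while strong convexity
   ([P_mid]) keeps [h] close to the near-best reply [g k] to [F k]. *)
Lemma minimax_sequence : exists V K : R, [/\ 0 <= V, V <= W, 0 <= K &
  exists g : nat -> G,
    (forall F k, exists h, (P F h <= (V + 2 * t k)%:E)%E /\ (D (g k) h <= (K * t k)%:E)%E) /\
    (forall k, exists h, (D (g k) h <= (K * t k)%:E)%E /\
       (D (g k.+1) h <= (K * (t k + t k.+1))%:E)%E)].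
Proof.
have [F0] := T0.
pose A := [set v : R | forall F, exists g, (P F g <= v%:E)%E].
have AW : A W by exact: P_le.
have A0 : lbound A 0.
  move=> v /(_ F0)[g]; have := P0 F0 g; move=> p0 /(le_trans p0).
  by rewrite lee_fin.
have lA : has_lbound A by exists 0.
have iA : has_inf A by split; [exists W|].
(* [V] is the maximin value, the supremum over [F] of the infimum over [g] of [P F g]; [V1] and [V2]
   are its two approximation properties. *)
pose V := inf A.
have V0 : 0 <= V by apply: lb_le_inf; [exists W|].
have VW : V <= W by exact: ge_inf.
have V1 e F : 0 < e -> exists g, (P F g <= (V + e)%:E)%E.
  move=> e0; have [v Av ve] := inf_adherent e0 iA.
  have [g Pg] := Av F; exists g; apply: (le_trans Pg).
  by rewrite lee_fin ltW.
have V2 e : 0 < e -> exists F, forall g, ((V - e)%:E < P F g)%E.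
  move=> e0; apply: contrapT => /forallNP nF.
  have : A (V - e).
    by move=> F; have /existsNP[g /negP] := nF F; rewrite -leNgt => ?; exists g.
  by move=> /(ge_inf lA); rewrite -/V; lra.
have t2 k : 0 < t k ^+ 2 by rewrite exprn_gt0.
have /choice[F HF] : forall k, exists F, forall g, ((V - t k ^+ 2)%:E < P F g)%E.
  by move=> k; exact: V2.
have /choice[g Hg] : forall k, exists g, (P (F k) g <= (V + t k ^+ 2)%:E)%E.
  by move=> k; exact: V1.
(* Near-best replies to [F k] are close: no midpoint can have payoff below [V - t k ^+ 2], which
   limits the convexity gain. *)
have Dle k (h h' : G) a b : (P (F k) h <= a%:E)%E -> (P (F k) h' <= b%:E)%E ->
    (D h h' <= ((a + b) / 2 - V + t k ^+ 2)%:E)%E.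
  move=> ha hb; have [m] := P_mid _ _ _ _ _ ha hb.
  have := ltW (HF k m); move=> /(@leeD2r _ (D h h')) le1 /(le_trans le1).
  case: (D h h') (D0 h h') => [d| |]//=.
  by rewrite -EFinD !lee_fin => _ ?; lra.
have key k F' : exists h, [/\ (P F' h <= (V + 2 * t k)%:E)%E &
    (D (g k) h <= ((V + 3) * t k)%:E)%E].
  have tk0 := t_gt0 k; have tkh := t_le k.
  have tk1 : t k < 1 by lra.
  have [F'' HF''] := P_mix (F k) F' _ tk0 tk1.
  (* The tolerance is quadratic since [F'] has weight [t k] in the mixture: dividing by this weight
     leaves an error of order [t k]. *)
  have [h Ph] := V1 _ F'' (t2 k).
  exists h; rewrite HF'' in Ph.
  have [a [b [Pa Pb a0 b0 ab]]] := ereal_convex_le _ _ _ _ tk0 tk1 (P0 _ _) (P0 _ _) Ph.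
  have aV : V - t k ^+ 2 <= a by have := ltW (HF k h); rewrite Pa lee_fin.
  split.
    rewrite Pb lee_fin -(ler_pM2l tk0).
    have := t2 k; nra.
  have Pa' : (P (F k) h <= a%:E)%E by rewrite Pa.
  apply: (le_trans (Dle _ _ _ _ _ (Hg k) Pa')).
  rewrite lee_fin.
  (* The nonnegative term [t k * b] is dropped; dividing by [1 - t k], which is at least 1/2, costs
     only a term of order [t k]. *)
  have a1 : a <= V + t k ^+ 2 + 2 * t k * (V + 1).
    have h1 : (1 - t k) * a <= V + t k ^+ 2 by nra.
    rewrite -(@ler_pM2l _ (1 - t k)); last by lra.
    apply: (le_trans h1).
    have : 0 <= t k * (1 - 2 * t k) * (V + 1) by rewrite !mulr_ge0//; lra.
    nra.
  nra.
exists V, (V + 3); split => //; first lra.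
exists g; split.
  by move=> F' k; have [h []] := key k F'; exists h.
(* With [F k.+1] as the challenger, the reply [h] is close to [g k] and also nearly best against
   [F k.+1], hence close to [g k.+1]. *)
move=> k; have [h [Ph Dh]] := key k (F k.+1).
exists h; split => //.
apply: (le_trans (Dle k.+1 _ _ _ _ (Hg k.+1) Ph)).
rewrite lee_fin.
have := t_gt0 k; have := t_gt0 k.+1; have := t_le k.+1 => h1 h2 h3.
have : t k.+1 ^+ 2 <= t k.+1 / 2 by rewrite expr2 ler_pM2l.
nra.
Qed.

End Minimax.

(** * Almost everywhere limits of estimators and lower semicontinuity of the Bayes risk *)

Section Limit.
Context {R : realType}.
Notation leb := (@lebesgue_measure R).

Lemma weighted_loss_ge0 (w m x y : R) :
  0 <= w -> 0 < m -> 0 <= w * (exp_density m x * y ^+ 2).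
Proof.
by move=> w0 m0; rewrite mulr_ge0// mulr_ge0 ?sqr_ge0// exp_density_ge0.
Qed.

(* Summing [4 ^ k] times the bounds keeps a finite integral, so almost everywhere the
   terms [4 ^ k * u k x ^+ 2] are bounded in [k]. *)
Lemma ae_geometric (u : nat -> R -> R) (K : R) :
  (forall k, measurable_fun setT (u k)) ->
  (forall k, (\int[leb]_(x in [set: R]) ((exp_density 1 x)%:E * (u k x ^+ 2)%:E)
     <= (K * 8^-1 ^+ k)%:E)%E) ->
  {ae leb, forall x, 0 <= x -> exists c, forall k, `|u k x| <= c * 2^-1 ^+ k}.
Proof.
move=> mu uK.
pose f k x := ((4 ^+ k)%:E * ((exp_density 1 x)%:E * (u k x ^+ 2)%:E))%E.
have d0 x : 0 <= exp_density 1 x :> R by exact: exp_density_ge0.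
have w0 k : 0 <= 4 ^+ k :> R by rewrite exprn_ge0.
have f0 k x : (0 <= f k x)%E.
  by rewrite /f -!EFinM lee_fin weighted_loss_ge0.
have mi k : measurable_fun setT (fun x : R => (exp_density 1 x)%:E * (u k x ^+ 2)%:E)%E.
  apply: emeasurable_funM; apply/measurable_EFinP; first exact: measurable_exp_density.
  exact: measurable_funX.
have mf k : measurable_fun setT (f k).
  by apply: (@measurable_funeM _ _ R setT _ (4 ^+ k)%:E); exact: mi.
have fK k : (\int[leb]_(x in [set: R]) f k x <= (K * 2^-1 ^+ k)%:E)%E.
  rewrite /f ge0_integralZl_EFin//.
  - apply: (@le_trans _ _ ((4 ^+ k)%:E * (K * 8^-1 ^+ k)%:E)%E).
      by apply: lee_wpmul2l; [rewrite lee_fin|exact: uK].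
    rewrite -EFinM lee_fin mulrCA -exprMn.
    by rewrite (_ : 4 * 8^-1 = 2^-1)//; field.
  - by move=> x _; rewrite -EFinM lee_fin mulr_ge0// sqr_ge0.
  - exact: mi.
pose Z x := (\sum_(0 <= k <oo) f k x)%E.
have Z0 x : (0 <= Z x)%E by apply: nneseries_ge0.
have mZ : measurable_fun setT Z by apply: ge0_emeasurable_sum.
have iZ : (\int[leb]_(x in [set: R]) Z x <= (K * 2)%:E)%E.
  rewrite integral_nneseries//; apply: lime_le.
    by apply: is_cvg_nneseries => k _ _; exact: integral_ge0.
  apply: nearW => n.
  have K0 : 0 <= K.
    have := fK 0%N; rewrite expr0 mulr1 -lee_fin; apply: le_trans.
    exact: integral_ge0.
  apply: (@le_trans _ _ (\sum_(0 <= k < n) (K * 2^-1 ^+ k)%:E)%E).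
    by apply: lee_sum => k _.
  rewrite sumEFin lee_fin -mulr_sumr ler_wpM2l//.
  rewrite [leLHS](_ : _ = 2 - 2 * 2^-1 ^+ n); last first.
    elim: n => [|n IH]; first by rewrite big_geq// expr0; ring.
    by rewrite big_nat_recr//= IH exprS; field.
  by rewrite gerBl mulr_ge0// exprn_ge0// invr_ge0.
have intZ : leb.-integrable setT Z.
  apply/integrableP; split => //.
  under eq_integral do rewrite gee0_abs//.
  by rewrite (le_lt_trans iZ)// ltry.
have aeZ := integrable_ae measurableT intZ.
apply: filterS aeZ => x /(_ Logic.I) Zfin x0.
(* The density with mean 1 is positive on the half-line, so it can be divided out of the bound by
   [Z x]; the square root then turns the factor 4 into 2. *)
have dx : 0 < exp_density 1 x :> R.
  by rewrite /exp_density x0 invr1 mul1r expR_gt0.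
pose M := fine (Z x) / exp_density 1 x.
exists (Num.sqrt M) => k.
have fle : (f k x <= Z x)%E.
  apply: (@le_trans _ _ (\sum_(0 <= i < k.+1) f i x)%E).
    by rewrite big_nat_recr//= leeDr// sume_ge0.
  exact: nneseries_lim_ge.
have fle' : 4 ^+ k * (exp_density 1 x * u k x ^+ 2) <= fine (Z x).
  by rewrite -lee_fin fineK.
have M0 : 0 <= M by rewrite divr_ge0// fine_ge0.
rewrite -(ler_pXn2r (n := 2))//; last first.
  by rewrite nnegrE mulr_ge0 ?sqrtr_ge0// exprn_ge0// invr_ge0.
rewrite exprMn sqr_sqrtr// real_normK ?num_real//.
rewrite -exprM mulnC exprM (_ : 2^-1 ^+ 2 = 4^-1); last by field.
rewrite exprVn ler_pdivlMr ?exprn_gt0// /M ler_pdivlMr//.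
by apply: le_trans fle'; rewrite le_eqVlt; apply/orP; left; apply/eqP; ring.
Qed.

(** Both [g k] and [g k.+1] are close to [h k], so by [ae_geometric] the increments of [g k x] are
    dominated by a geometric sequence for almost every [x >= 0]. *)
Lemma ae_limit (g h : nat -> R -> R) (K : R) :
  (forall k, measurable_fun setT (g k)) -> (forall k, measurable_fun setT (h k)) ->
  (forall k, (\int[leb]_(x in [set: R])
     ((exp_density 1 x)%:E * ((g k x - h k x) ^+ 2)%:E) <= (K * 8^-1 ^+ k)%:E)%E) ->
  (forall k, (\int[leb]_(x in [set: R])
     ((exp_density 1 x)%:E * ((g k.+1 x - h k x) ^+ 2)%:E) <= (K * 8^-1 ^+ k)%:E)%E) ->
  exists G : R -> R, measurable_fun setT G /\
    {ae leb, forall x, 0 <= x -> g k x @[k --> \oo] --> G x}.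
Proof.
move=> mg mh H1 H2.
(* The upper limit is measurable everywhere and equals the limit wherever the sequence converges;
   [fine] replaces infinite values by 0. *)
exists (fun x => fine (limn_esup (fun k => (g k x)%:E))); split.
  apply: measurableT_comp => //.
  by apply: measurable_fun_limn_esup => k; exact/measurable_EFinP.
have A1 := ae_geometric _ _ (fun k => measurable_funB (mg k) (mh k)) H1.
have A2 := ae_geometric _ _ (fun k => measurable_funB (mg k.+1) (mh k)) H2.
have FF : Filter (almost_everywhere leb) by exact: ae_filter_ringOfSetsType.
apply: (filterS2 FF _ A1 A2) => x B1 B2 x0.
have [c1 Hc1] := B1 x0; have [c2 Hc2] := B2 x0.
have cg : cvgn (fun k => g k x).
  rewrite (_ : (fun k => g k x) = fun k => g 0%N x + series (telescope (g ^~ x)) k); last first.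
    by apply/funext => k; rewrite -(eq_sum_telescope (g ^~ x) k).
  apply: is_cvgD; first exact: is_cvg_cst.
  apply: normed_cvg.
  apply: (@series_le_cvg _ _ (geometric (c1 + c2) 2^-1)) => //.
  - by move=> k; exact: normr_ge0.
  - move=> k; rewrite /geometric /=; apply: (@le_trans _ _ (`|g k x - h k x| + `|g k.+1 x - h k x|)).
      exact: addr_ge0.
    by rewrite mulrDl lerD//; [exact: Hc1|exact: Hc2].
  - move=> k; rewrite /geometric /= mulrDl /telescope /mk_sequence.
    rewrite (_ : g k.+1 x - g k x = (g k.+1 x - h k x) - (g k x - h k x)); last by ring.
    by rewrite (le_trans (ler_normB _ _))// addrC lerD//; [exact: Hc1|exact: Hc2].
  - by apply: is_cvg_geometric_series; rewrite ger0_norm ?invr_ge0// invf_lt1// ltr1n.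
have /cvg_ex[l gl] := cg.
suff -> : fine (limn_esup (fun k => (g k x)%:E)) = l by [].
have : (g k x)%:E @[k --> \oo] --> l%:E by apply: cvg_EFin => //; exact: nearW.
by move=> /cvg_limn_einf_sup[_ ->].
Qed.

(** The differences tend to 0 almost everywhere on the half-line by [ae_geometric]. Thus replies
    adapted to different priors inherit one common limit. *)
Lemma ae_limit_close (g h : nat -> R -> R) (G : R -> R) (K : R) :
  (forall k, measurable_fun setT (g k)) -> (forall k, measurable_fun setT (h k)) ->
  (forall k, (\int[leb]_(x in [set: R])
     ((exp_density 1 x)%:E * ((g k x - h k x) ^+ 2)%:E) <= (K * 8^-1 ^+ k)%:E)%E) ->
  {ae leb, forall x, 0 <= x -> g k x @[k --> \oo] --> G x} ->
  {ae leb, forall x, 0 <= x -> h k x @[k --> \oo] --> G x}.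
Proof.
move=> mg mh H gG.
have A1 := ae_geometric _ _ (fun k => measurable_funB (mg k) (mh k)) H.
have FF : Filter (almost_everywhere leb) by exact: ae_filter_ringOfSetsType.
apply: (filterS2 FF _ A1 gG) => x B1 gx x0.
have [c Hc] := B1 x0.
have u0 : g k x - h k x @[k --> \oo] --> (0 : R).
  apply: norm_cvg0.
  apply: (@squeeze_cvgr _ _ _ _ (cst 0) (geometric c 2^-1)).
  - by apply: nearW => k /=; rewrite normr_ge0 Hc.
  - exact: cvg_cst.
  - by apply: cvg_geometric; rewrite ger0_norm ?invr_ge0// invf_lt1// ltr1n.
rewrite (_ : (fun k => h k x) = fun k => g k x - (g k x - h k x)); last first.
  by apply/funext => k; rewrite subKr.
by rewrite -[G x]subr0; apply: cvgB => //; exact: gx.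
Qed.

(** A single integral is the form to which Fatou's lemma applies. *)
Lemma bayesE F (g : R -> R) : measurable_fun setT g ->
  (forall q, q \in F -> 0 <= q.1 /\ 0 < q.2) ->
  bayes F g = (\int[leb]_(x in [set: R])
    (\sum_(q <- F) q.1 * (exp_density q.2 x * (g x - ln q.2) ^+ 2))%:E)%E.
Proof.
move=> mg F0.
rewrite /bayes.
(* Absolute values make every summand nonnegative for arbitrary pairs, and change nothing on the
   entries of [F]. A zero mean gives density 0 because [0^-1] is 0. *)
transitivity (\sum_(q <- F) \int[leb]_(x in [set: R])
   ((`|q.1| * (exp_density `|q.2| x * (g x - ln `|q.2|) ^+ 2))%:E))%E.
  rewrite !big_seq; apply: eq_bigr => q /F0[q1 q2].
  rewrite !ger0_norm ?(ltW q2)// /risk -ge0_integralZl_EFin//.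
  - by move=> x _; rewrite -EFinM lee_fin mulr_ge0 ?sqr_ge0// exp_density_ge0.
  - exact: measurable_risk_integrand.
rewrite -ge0_integral_sum//.
- apply: eq_integral => x _; rewrite sumEFin; congr EFin.
  rewrite !big_seq; apply: eq_bigr => q /F0[q1 q2].
  by rewrite !ger0_norm ?(ltW q2).
- move=> q; apply/measurable_EFinP; apply: measurable_funM => //.
  apply: measurable_funM; first exact: measurable_exp_density.
  by apply: measurable_funX; exact: measurable_funB.
- move=> q x _; rewrite lee_fin mulr_ge0// mulr_ge0 ?sqr_ge0//.
  have [->|q0] := eqVneq q.2 0; first by rewrite normr0 /exp_density invr0 mul0r; case: ifP.
  by rewrite exp_density_ge0// normr_gt0.
Qed.

(** Fatou's lemma: the integrand at [G] is almost everywhere the lower limit of the integrands at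
    [h k]. *)
Lemma bayes_limit F (h : nat -> R -> R) (G : R -> R) (b : nat -> R) (V : R) :
  (forall q, q \in F -> 0 <= q.1 /\ 0 < q.2) ->
  (forall k, measurable_fun setT (h k)) -> measurable_fun setT G ->
  {ae leb, forall x, 0 <= x -> h k x @[k --> \oo] --> G x} ->
  (forall k, (bayes F (h k) <= (b k)%:E)%E) -> b k @[k --> \oo] --> V ->
  (bayes F G <= V%:E)%E.
Proof.
move=> F0 mh mG hG hb bV.
pose psi (g : R -> R) x := (\sum_(q <- F) q.1 * (exp_density q.2 x * (g x - ln q.2) ^+ 2))%:E.
have psi0 g x : (0 <= psi g x)%E.
  rewrite lee_fin big_seq; apply: sumr_ge0 => q /F0[q1 q2].
  exact: weighted_loss_ge0.
have mpsi g : measurable_fun setT g -> measurable_fun setT (psi g).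
  move=> mg; apply/measurable_EFinP; apply: measurable_sum => q.
  apply: measurable_funM => //.
  apply: measurable_funM; first exact: measurable_exp_density.
  by apply: measurable_funX; exact: measurable_funB.
rewrite bayesE//.
apply: (@le_trans _ _ (\int[leb]_(x in [set: R]) limn_einf (fun k => psi (h k) x))%E).
  rewrite le_eqVlt; apply/orP; left; apply/eqP.
  apply: ge0_ae_eq_integral => //.
  - exact: mpsi.
  - rewrite (_ : (fun x => _) = fun x => (- limn_esup (fun k => - psi (h k) x))%E); last first.
      by apply/funext => x; rewrite -limn_einfN; congr limn_einf; apply/funext => k; rewrite /comp oppeK.
    apply: measurableT_comp => //.
    by apply: measurable_fun_limn_esup => k; apply: measurableT_comp => //; exact: mpsi.
  - by move=> x _; exact: psi0.
  - move=> x _; rewrite limn_einf_lim; apply: lime_ge; first exact: is_cvg_einfs.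
    by apply: nearW => k; apply: le_ereal_inf_tmp => _ [j _ <-].
  - have FF : Filter (almost_everywhere leb) by exact: ae_filter_ringOfSetsType.
    apply: (filterS _ hG) => x hGx _; symmetry.
    apply: (fun u l H => (@cvg_limn_einf_sup R u l H).1).
    apply: cvg_EFin; first exact: nearW.
    (* For negative [x] all densities vanish and the integrand is constant in [k], so convergence of
       [h k x] is needed on the half-line only. *)
    have [x0|x0] := leP 0 x; last first.
      rewrite [X in X @ _ --> _](_ : _ = cst (\sum_(q <- F) q.1 * (exp_density q.2 x * (G x - ln q.2) ^+ 2))).
        exact: cvg_cst.
      apply/funext => k /=; apply: eq_bigr => q _.
      by rewrite /exp_density leNgt x0 /= !mul0r.
    apply: cvg_big => [|q _]; first exact: add_continuous.
    apply: cvgM; first exact: cvg_cst.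
    apply: cvgM; first exact: cvg_cst.
    rewrite expr2; under eq_fun do rewrite expr2.
    by apply: cvgM; (apply: cvgB; [exact: hGx|exact: cvg_cst]).
have fat := @fatou _ _ R leb setT measurableT (fun k => psi (h k))
  (fun k => mpsi _ (mh k)) (fun k x _ => psi0 (h k) x).
apply: (le_trans fat).
rewrite limn_einf_lim.
have bVE : (b k)%:E @[k --> \oo] --> V%:E by apply: cvg_EFin => //; exact: nearW.
rewrite -(cvg_lim _ bVE)//; apply: lee_lim.
- exact: is_cvg_einfs.
- by apply/cvg_ex; exists V%:E.
- apply: nearW => k.
  apply: le_trans (hb k); apply: ereal_inf_lbound.
  by exists k => //=; rewrite bayesE.
Qed.

End Limit.

(** * Minimax theorem for finitely supported priors *)

Section FiniteMinimax.
Context {R : realType}.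
Notation leb := (@lebesgue_measure R).

Definition finite_prior_class (p eta : R) (F : seq (R * R)) : Prop :=
  [/\ forall q, q \in F -> 0 <= q.1 /\ 1 <= q.2, \sum_(q <- F) q.1 = 1 &
      \sum_(q <- F) q.1 * powR (ln q.2) p <= powR eta p].

Definition mixture (t : R) (F F' : seq (R * R)) : seq (R * R) :=
  [seq ((1 - t) * q.1, q.2) | q <- F] ++ [seq (t * q.1, q.2) | q <- F'].

Lemma finite_prior_class_point (p eta m : R) : 1 <= m -> powR (ln m) p <= powR eta p ->
  finite_prior_class p eta [:: (1, m)].
Proof.
move=> m1 mc; split; rewrite ?big_seq1/= ?mul1r//.
by move=> q; rewrite inE => /eqP ->.
Qed.

Lemma mixture_sum (t : R) (F F' : seq (R * R)) (a : R -> R) :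
  \sum_(q <- mixture t F F') q.1 * a q.2 =
  (1 - t) * \sum_(q <- F) q.1 * a q.2 + t * \sum_(q <- F') q.1 * a q.2.
Proof.
rewrite big_cat !big_map /= !mulr_sumr.
by congr (_ + _); apply: eq_bigr => q _; rewrite mulrA.
Qed.

Lemma mixture_class (p eta t : R) (F F' : seq (R * R)) : 0 <= t -> t <= 1 ->
  finite_prior_class p eta F -> finite_prior_class p eta F' ->
  finite_prior_class p eta (mixture t F F').
Proof.
move=> t0 t1 [F0 F1 Fc] [F0' F1' Fc']; have t10 : 0 <= 1 - t by rewrite subr_ge0.
split.
- move=> q; rewrite mem_cat => /orP[] /mapP[q' qF ->] /=.
    by have [? ?] := F0 _ qF; split => //; exact: mulr_ge0.
  by have [? ?] := F0' _ qF; split => //; exact: mulr_ge0.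
- have := mixture_sum t F F' (fun=> 1).
  under eq_bigr do rewrite mulr1.
  under [in X in _ = X -> _]eq_bigr do rewrite mulr1.
  under [X in _ = _ + _ * X -> _]eq_bigr do rewrite mulr1.
  by move=> ->; rewrite F1 F1'; ring.
- rewrite (mixture_sum t F F' (fun m => powR (ln m) p)); nra.
Qed.

Lemma bayes_ge0 (F : seq (R * R)) (g : R -> R) :
  (forall q, q \in F -> 0 <= q.1 /\ 1 <= q.2) -> (0 <= bayes F g)%E.
Proof.
move=> F0; rewrite /bayes big_seq; apply: sume_ge0 => q /F0[q1 q2].
apply: mule_ge0; first by rewrite lee_fin.
by apply: risk_ge0; exact: lt_le_trans q2.
Qed.

Lemma bayes_mixture (t : R) (F F' : seq (R * R)) (g : R -> R) : 0 <= t -> t <= 1 ->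
  (forall q, q \in F -> 0 <= q.1 /\ 1 <= q.2) ->
  (forall q, q \in F' -> 0 <= q.1 /\ 1 <= q.2) ->
  bayes (mixture t F F') g = ((1 - t)%:E * bayes F g + t%:E * bayes F' g)%E.
Proof.
move=> t0 t1 F0 F0'.
have scale (c : R) (L : seq (R * R)) : (forall q, q \in L -> 0 <= q.1 /\ 1 <= q.2) ->
    (\sum_(q <- [seq ((c * q.1)%R, q.2) | q <- L]) q.1%:E * risk g q.2 = c%:E * bayes L g)%E.
  move=> L0; rewrite big_map /= /bayes big_seq [in RHS]big_seq ge0_sume_distrr.
    by apply: eq_bigr => q _; rewrite EFinM muleA.
  move=> q /L0[q1 q2]; apply: mule_ge0; first by rewrite lee_fin.
  by apply: risk_ge0; exact: lt_le_trans q2.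
by rewrite {1}/bayes big_cat /= !scale.
Qed.

Definition sqdist (m : R) (g h : R -> R) : \bar R :=
  (\int[leb]_(x in [set: R]) ((exp_density m x)%:E * ((g x - h x) ^+ 2)%:E))%E.

Lemma sqdist_ge0 (m : R) (g h : R -> R) : 0 < m -> (0 <= sqdist m g h)%E.
Proof.
move=> m0; apply: integral_ge0 => x _.
by rewrite -EFinM lee_fin mulr_ge0 ?sqr_ge0// exp_density_ge0.
Qed.

Definition midpoint (g h : R -> R) (x : R) : R := (g x + h x) / 2.

Lemma measurable_midpoint (g h : R -> R) : measurable_fun setT g ->
  measurable_fun setT h -> measurable_fun setT (midpoint g h).
Proof. by move=> mg mh; apply: measurable_funM => //; exact: measurable_funD. Qed.

(** Integrate [u^2 + v^2 = 2((u + v)/2)^2 + (u - v)^2/2] with [u = g - ln m] and [v = h - ln m]. The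
    additive form remains valid for infinite risks. *)
Lemma risk_parallelogram (g h : R -> R) (m : R) : 0 < m ->
  measurable_fun setT g -> measurable_fun setT h ->
  (risk g m + risk h m =
   2%:E * risk (midpoint g h) m + 2^-1%:E * sqdist m g h)%E.
Proof.
move=> m0 mg mh.
have nn (u : R) x : (0 <= (exp_density m x)%:E * (u ^+ 2)%:E)%E.
  by rewrite -EFinM lee_fin mulr_ge0 ?sqr_ge0// exp_density_ge0.
have ml (u v : R -> R) : measurable_fun setT u -> measurable_fun setT v ->
    measurable_fun setT (fun x => (exp_density m x)%:E * ((u x - v x) ^+ 2)%:E)%E.
  move=> mu mv; apply: emeasurable_funM; apply/measurable_EFinP.
    exact: measurable_exp_density.
  by apply: measurable_funX; exact: measurable_funB.
have mmid := measurable_midpoint g h mg mh.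
rewrite /risk /sqdist -ge0_integralD//; [|exact: ml|exact: ml].
rewrite -ge0_integralZl_EFin//; last exact: ml.
rewrite -ge0_integralZl_EFin//; last exact: ml.
rewrite -ge0_integralD//.
- apply: eq_integral => x _; rewrite -!EFinM -!EFinD; by congr EFin; rewrite /midpoint; field.
- by move=> x _; apply: mule_ge0; [rewrite lee_fin|exact: nn].
- by apply: (@measurable_funeM _ _ R setT _ 2%:E); exact: ml.
- by move=> x _; apply: mule_ge0; [rewrite lee_fin invr_ge0|exact: nn].
- by apply: (@measurable_funeM _ _ R setT _ 2^-1%:E); exact: ml.
Qed.

Lemma risk_midpoint (g h : R -> R) (m a b : R) : 0 < m ->
  measurable_fun setT g -> measurable_fun setT h ->
  risk g m = a%:E -> risk h m = b%:E ->
  exists c d, [/\ risk (midpoint g h) m = c%:E, sqdist m g h = d%:E,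
    0 <= d & a + b = 2 * c + d / 2].
Proof.
move=> m0 mg mh ga hb; have := risk_parallelogram g h m m0 mg mh.
rewrite ga hb.
have := risk_ge0 (midpoint g h) m m0.
have := sqdist_ge0 m g h m0.
case: (sqdist m g h) => [d| |]//; case: (risk _ m) => [c| |]//.
- rewrite !lee_fin => d0 c0 [E]; exists c, d; split => //.
  by rewrite E; field.
- by move=> _ _; rewrite gt0_muley ?lte_fin// addye// -EFinM.
- by move=> _ _; rewrite [X in _ = (_ + X)%E]gt0_muley ?lte_fin ?invr_gt0// addey// -EFinM.
- by move=> _ _; rewrite !gt0_muley ?lte_fin ?invr_gt0.
Qed.

(** The distances in the parallelogram identity are dropped, leaving plain convexity; the uniform
    gain will come from the mass at 1. *)
Lemma bayes_midpoint (F : seq (R * R)) (g h : R -> R) (a b : R) :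
  (forall q, q \in F -> 0 <= q.1 /\ 1 <= q.2) ->
  measurable_fun setT g -> measurable_fun setT h ->
  bayes F g = a%:E -> bayes F h = b%:E ->
  (bayes F (midpoint g h) <= ((a + b) / 2)%:E)%E.
Proof.
move=> F0 mg mh ga hb.
have : (2%:E * bayes F (midpoint g h) <= bayes F g + bayes F h)%E.
  rewrite /bayes -big_split /= big_seq [in leRHS]big_seq ge0_sume_distrr; last first.
    move=> q /F0[q1 q2]; apply: mule_ge0; first by rewrite lee_fin.
    by apply: risk_ge0; exact: lt_le_trans q2.
  apply: lee_sum => q /F0[q1 q2]; have q0 : 0 < q.2 by exact: lt_le_trans q2.
  rewrite muleCA -ge0_muleDr ?risk_ge0//; apply: lee_wpmul2l; first by rewrite lee_fin.
  by rewrite risk_parallelogram// leeDl// mule_ge0 ?sqdist_ge0.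
rewrite ga hb; case: (bayes F _) => [c| |] //.
  by rewrite -EFinM -EFinD !lee_fin; lra.
  by rewrite gt0_muley ?lte_fin.
by rewrite leNye.
Qed.

(** Mixing with a fixed term commutes with mixing two priors. Nonnegativity supplies distributivity
    in the extended reals. *)
Lemma mixture_assoc_ereal (r s : R) (x y z : \bar R) :
  0 < r -> r < 1 -> 0 < s -> s < 1 -> (0 <= x)%E -> (0 <= y)%E -> (0 <= z)%E ->
  ((1 - s)%:E * ((1 - r)%:E * x + r%:E * y) + s%:E * z =
   (1 - r)%:E * ((1 - s)%:E * x + s%:E * z) + r%:E * ((1 - s)%:E * y + s%:E * z))%E.
Proof.
move=> r0 r1 s0 s1 x0 y0 z0.
have r10 : 0 < 1 - r by rewrite subr_gt0.
have s10 : 0 < 1 - s by rewrite subr_gt0.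
have nn (c : R) u : 0 < c -> (0 <= u)%E -> (0 <= c%:E * u)%E.
  by move=> c0 u0; apply: mule_ge0 => //; rewrite lee_fin ltW.
rewrite !ge0_muleDr ?nn// !muleA addeACA -!EFinM.
rewrite -[X in _ = (_ + X)%E]ge0_muleDl ?lee_fin ?mulr_ge0 ?ltW//.
rewrite -EFinD (_ : (1 - r) * s + r * s = s); last by ring.
by rewrite [(1 - s) * (1 - r)]mulrC [(1 - s) * r]mulrC.
Qed.

(* The term [s * risk g 1] provides the strong convexity, uniformly in the prior. *)
Lemma finite_minimax (p eta W s : R) : 0 < p -> 0 < s -> s < 1 ->
  (forall F, finite_prior_class p eta F ->
    exists2 g, measurable_fun setT g & (bayes F g <= W%:E)%E) ->
  exists2 g : R -> R, measurable_fun setT g & forall F, finite_prior_class p eta F ->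
    ((1 - s)%:E * bayes F g + s%:E * risk g 1 <= W%:E)%E.
Proof.
move=> p0 s0 s1 HW.
have s10 : 0 < 1 - s by rewrite subr_gt0.
pose D1 : seq (R * R) := [:: (1, 1)].
have D1c : finite_prior_class p eta D1.
  by apply: finite_prior_class_point => //; rewrite ln1 powR0 ?gt_eqF// powR_ge0.
pose T := {F | finite_prior_class p eta F}.
pose G := {g : R -> R | measurable_fun setT g}.
pose P (F : T) (g : G) : \bar R :=
  ((1 - s)%:E * bayes (sval F) (sval g) + s%:E * risk (sval g) 1)%E.
(* The midpoint gains a quarter of the squared distance in its risk at 1, and this risk has weight
   [s]. *)
pose D (g h : G) : \bar R := ((s / 4)%:E * sqdist 1 (sval g) (sval h))%E.
have PE (F : T) (g : G) : P F g = bayes (mixture s (sval F) D1) (sval g).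
  case: F => F [F0 ? ?]; rewrite /P bayes_mixture ?ltW//; last by case: D1c.
  by congr (_ + _ * _)%E; rewrite /bayes big_seq1 mul1e.
have c0 (F : T) : forall q, q \in sval F -> 0 <= q.1 /\ 1 <= q.2.
  by case: F => F [].
have b0 (F : T) (g : G) : (0 <= bayes (sval F) (sval g))%E by exact: (bayes_ge0 _ _ (c0 F)).
have r0 (g : G) : (0 <= risk (sval g) 1)%E by exact: risk_ge0.
have P0 (F : T) (g : G) : (0 <= P F g)%E.
  by apply: adde_ge0; apply: mule_ge0 => //; rewrite lee_fin ltW.
have D0 (g h : G) : (0 <= D g h)%E.
  by apply: mule_ge0; [rewrite lee_fin divr_ge0// ltW|exact: sqdist_ge0].
have Pmix (F F' : T) r : 0 < r -> r < 1 -> exists F'' : T, forall g : G,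
    P F'' g = ((1 - r)%:E * P F g + r%:E * P F' g)%E.
  move=> r0' r1.
  have cl := mixture_class p eta r (sval F) (sval F') (ltW r0') (ltW r1) (svalP F) (svalP F').
  exists (exist _ _ cl) => g.
  rewrite /P /= bayes_mixture ?ltW//; [|exact: c0|exact: c0].
  exact: mixture_assoc_ereal.
have Pmid (F : T) (g h : G) a b : (P F g <= a%:E)%E -> (P F h <= b%:E)%E ->
    exists m : G, (P F m + D g h <= ((a + b) / 2)%:E)%E.
  move=> ga hb.
  have [a1 [a2 [Ba Ra a10 a20 Ha]]] := ereal_convex_le _ _ _ _ s0 s1 (b0 F g) (r0 g) ga.
  have [b1 [b2 [Bb Rb b10 b20 Hb]]] := ereal_convex_le _ _ _ _ s0 s1 (b0 F h) (r0 h) hb.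
  have mg := svalP g; have mh := svalP h.
  exists (exist _ _ (measurable_midpoint _ _ mg mh)).
  have [c [d [Rc Dd d0 cd]]] := risk_midpoint _ _ _ _ _ ltr01 mg mh Ra Rb.
  have := bayes_midpoint _ _ _ _ _ (c0 F) mg mh Ba Bb.
  have := bayes_ge0 _ (midpoint (sval g) (sval h)) (c0 F).
  rewrite /P /D /= Rc Dd.
  case: (bayes _ _) => [e| |]//; rewrite !lee_fin => e0 He.
  have h1 : (1 - s) * e <= (1 - s) * ((a1 + b1) / 2) by rewrite ler_wpM2l// ltW.
  have cE : c = (a2 + b2) / 2 - d / 4 by lra.
  by rewrite cE; lra.
have Ple (F : T) : exists g : G, (P F g <= W%:E)%E.
  have cl := mixture_class p eta s (sval F) D1 (ltW s0) (ltW s1) (svalP F) D1c.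
  have [g mg gW] := HW _ cl.
  by exists (exist _ g mg); rewrite PE.
(* The factor 1/2 meets the bound on step sizes; the ratio 1/8 is the rate that [ae_geometric]
   expects. *)
pose t (k : nat) : R := 2^-1 * 8^-1 ^+ k.
have e0 (k : nat) : 0 < 8^-1 ^+ k :> R by rewrite exprn_gt0.
have t0 k : 0 < t k by rewrite mulr_gt0.
have tle k : t k <= 2^-1.
  by rewrite ler_piMr// exprn_ile1// invf_le1// ler1n.
have [V [K [V0 VW K0 [g [gF gC]]]]] := minimax_sequence P D W t
  (inhabits (exist _ D1 D1c)) P0 D0 Pmix Pmid Ple t0 tle.
have mg k := svalP (g k).
(* This undoes the factor [s / 4] in [D]; both distance bounds involve at most [2 * t k], which
   equals [8^-1 ^+ k]. *)
pose K2 := 4 * K / s.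
have DE (u v : G) c k : c <= 2 * t k -> (D u v <= (K * c)%:E)%E ->
    (sqdist 1 (sval u) (sval v) <= (K2 * 8^-1 ^+ k)%:E)%E.
  move=> ct; rewrite /D; case: (sqdist 1 _ _) (sqdist_ge0 1 (sval u) (sval v) ltr01) => [d| |]//.
    rewrite -EFinM !lee_fin => d0 sd.
    rewrite /K2 mulrAC ler_pdivlMr//.
    have : K * c <= K * (2 * t k) by rewrite ler_wpM2l.
    by rewrite /t; lra.
  by rewrite gt0_muley// lte_fin divr_gt0.
have tt k : t k <= 2 * t k by have := t0 k; lra.
have ts k : t k + t k.+1 <= 2 * t k.
  by rewrite /t exprS; have := e0 k; lra.
have /choice[h Hh] := gC.
have mh k := svalP (h k).
have [G0 [mG0 gG]] := ae_limit (fun k => sval (g k)) (fun k => sval (h k)) K2 mg mh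
  (fun k => DE _ _ _ k (tt k) (Hh k).1) (fun k => DE _ _ _ k (ts k) (Hh k).2).
exists G0 => // F Fc.
pose F' : T := exist _ F Fc.
(* [G0] is chosen before [F]. The replies [h'] depend on [F], but they stay close to [g] and so
   converge to the same [G0]. *)
have /choice[h' Hh'] := gF F'.
have mh' k := svalP (h' k).
have hG := ae_limit_close _ (fun k => sval (h' k)) _ K2 mg mh'
  (fun k => DE _ _ _ k (tt k) (Hh' k).2) gG.
have [cl0 _ _] := mixture_class p eta s F D1 (ltW s0) (ltW s1) Fc D1c.
suff : (P F' (exist _ G0 mG0) <= V%:E)%E.
  by move=> /le_trans; apply; rewrite lee_fin.
rewrite PE.
apply: (bayes_limit _ (fun k => sval (h' k)) _ (fun k => V + 2 * t k)) => //.
- by move=> q /cl0[q1 q2]; split => //; exact: lt_le_trans q2.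
- by move=> k; rewrite -(PE F'); exact: (Hh' k).1.
- rewrite -[X in _ --> X]addr0; apply: cvgD; first exact: cvg_cst.
  rewrite (_ : (fun k => 2 * t k) = geometric 1 8^-1).
    by apply: cvg_geometric; rewrite ger0_norm ?invr_ge0// invf_lt1// ltr1n.
  by apply/funext => k; rewrite /t /geometric /=; field.
Qed.

End FiniteMinimax.

(** * Comparison of the two risks *)

Section Risks.
Context {R : realType}.
Notation leb := (@lebesgue_measure R).
Implicit Types (p eta S : R) (F : seq (R * R)).

(* The two-point priors straddling the moment constraint give the supporting line. *)
Lemma risk_affine_majorant p eta S (g : R -> R) : 0 < p -> 0 < eta ->
  (forall F, finite_prior_class p eta F -> (bayes F g <= S%:E)%E) ->
  exists2 lam, 0 <= lam & forall m, 1 <= m ->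
    (risk g m + (lam * powR eta p)%:E <= (S + lam * powR (ln m) p)%:E)%E.
Proof.
move=> p0 eta0 HF.
pose a m : R := powR (ln m) p; pose c : R := powR eta p.
have c0 : 0 < c by exact: powR_gt0.
have a1 : a 1 = 0 by rewrite /a ln1 powR0// gt_eqF.
(* The weights are those for which the moment constraint holds with equality. *)
have two m1 m2 : 1 <= m1 -> 1 <= m2 -> a m1 < c -> c < a m2 ->
    (((a m2 - c) / (a m2 - a m1))%:E * risk g m1 +
     ((c - a m1) / (a m2 - a m1))%:E * risk g m2 <= S%:E)%E.
  move=> m11 m21 am1 am2; have d0 : 0 < a m2 - a m1 by lra.
  have := HF [:: ((a m2 - c) / (a m2 - a m1), m1); ((c - a m1) / (a m2 - a m1), m2)].
  rewrite /bayes !big_cons big_nil adde0; apply; split.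
  - move=> q; rewrite !inE => /orP[] /eqP -> /=; split => //.
      by rewrite divr_ge0 ?ltW// subr_gt0.
    by rewrite divr_ge0 ?ltW// subr_gt0.
  - by rewrite !big_cons big_nil /=; field; rewrite gt_eqF.
  - rewrite !big_cons big_nil /= -/(a m1) -/(a m2) -/c le_eqVlt; apply/orP; left.
    by apply/eqP; field; rewrite gt_eqF.
have pos (m : R) : 1 <= m -> 0 < m by exact: lt_le_trans.
have one m : 1 <= m -> a m <= c -> (risk g m <= S%:E)%E.
  move=> m1 am; have := HF _ (finite_prior_class_point p eta m m1 am).
  by rewrite /bayes big_seq1 mul1e.
(* Beyond the constraint, [m] has positive weight in a two-point prior with [1], so an infinite risk
   would contradict the bound [S]. *)
have fin m : 1 <= m -> exists2 r, risk g m = r%:E & 0 <= r.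
  move=> m1; have := risk_ge0 g m (pos m m1).
  have [am|am] := leP (a m) c.
    by have := one m m1 am; case: (risk g m) => [r| |]// _; rewrite lee_fin; exists r.
  have a1c : a 1 < c by rewrite a1.
  have := two 1 m (lexx 1) m1 a1c am.
  have := risk_ge0 g 1 ltr01.
  have w0 : 0 < (c - a 1) / (a m - a 1) by rewrite divr_gt0 ?subr_gt0// (lt_trans a1c).
  have w1 : 0 <= (a m - c) / (a m - a 1).
    by rewrite divr_ge0 ?subr_ge0 ?ltW// (lt_trans a1c).
  case: (risk g m) => [r| |]//; first by rewrite lee_fin; exists r.
  move=> r1; rewrite gt0_muley ?lte_fin// addey//.
  by rewrite gt_eqF// (lt_le_trans (ltNye_eq 0))// mule_ge0.
pose r m := fine (risk g m).
have rE m : 1 <= m -> risk g m = (r m)%:E by move=> /fin[x]; rewrite /r => ->.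
have r0 m : 1 <= m -> 0 <= r m by move=> /fin[x]; rewrite /r => ->.
have rS m : 1 <= m -> a m <= c -> r m <= S.
  by move=> m1 am; rewrite -lee_fin -rE//; exact: one.
(* Each point with [a m < c] bounds the admissible slopes from above, each point with [a m > c] from
   below. By [two] every lower bound is below every upper bound, so the infimum of the upper bounds
   is a valid slope. *)
pose A := [set (S - r m) / (c - a m) | m in [set m | 1 <= m /\ a m < c]].
have A1 : A ((S - r 1) / (c - a 1)) by exists 1 => //=; rewrite a1.
have lA : lbound A 0.
  move=> _ [m [m1 am] <-]; rewrite divr_ge0 ?subr_ge0 ?(ltW am)//.
  by apply: rS => //; exact: ltW.
have hA : has_lbound A by exists 0.
exists (inf A) => [|m m1]; first by apply: lb_le_inf => //; exists ((S - r 1) / (c - a 1)).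
rewrite rE// -EFinD lee_fin -/(a m) -/c.
have [am|am|am] := ltgtP (a m) c.
- have : inf A <= (S - r m) / (c - a m) by apply: ge_inf => //; exists m.
  by rewrite ler_pdivlMr ?subr_gt0//; lra.
- suff : (r m - S) / (a m - c) <= inf A by rewrite ler_pdivrMr ?subr_gt0//; lra.
  apply: lb_le_inf; first by exists ((S - r 1) / (c - a 1)).
  move=> _ [m1' [m11 am1] <-].
  rewrite ler_pdivrMr ?subr_gt0// mulrAC ler_pdivlMr ?subr_gt0//.
  have := two m1' m m11 m1 am1 am; rewrite !rE// -!EFinM -EFinD lee_fin.
  have d0 : 0 < a m - a m1' by lra.
  rewrite mulrAC [X in _ + X]mulrAC -mulrDl ler_pdivrMr//; lra.
- by rewrite am lerD2r; apply: rS; rewrite ?am.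
Qed.

(** Clipping the mean at 1 changes nothing on the domain and makes it positive everywhere, as
    [measurable_risk] requires. *)
Lemma measurable_risk_ge1 (g : R -> R) : measurable_fun setT g ->
  measurable_fun (`[1%R, +oo[%classic : set R) (risk g).
Proof.
move=> mg; apply: (@eq_measurable_fun _ _ R (\bar R) _ (fun m : R => risk g (Num.max m 1))).
  move=> m; rewrite inE/= in_itv/= andbT => m1.
  by rewrite (max_idPl m1).
apply: measurable_funTS.
have mg2 : measurable_fun setT (fun z : R * R => g z.2) by exact: (measurableT_comp mg).
have mmax : measurable_fun setT (fun m : R => Num.max m 1) by exact: measurable_maxr.
have max0 (m : R) : 0 < Num.max m 1 by rewrite lt_max ltr01 orbT.
exact: (measurable_risk _ _ mg2 mmax max0).
Qed.

Lemma measurable_ln_moment p : measurable_fun [set: R] (fun m => powR (ln m) p).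
Proof. exact: (measurableT_comp (measurable_powR p) (@measurable_ln R)). Qed.

Lemma univ_bayes_risk_le p eta S lam (d : R -> R) (P : probability R R) :
  0 <= S -> 0 <= lam -> measurable_fun setT d ->
  (forall m, 1 <= m -> (risk (fun x => ln (d x)) m + (lam * powR eta p)%:E <=
    (S + lam * powR (ln m) p)%:E)%E) ->
  univ_prior_class p eta P -> (univ_bayes_risk P d <= S%:E)%E.
Proof.
move=> S0 lam0 md H [PD Pc].
have mg : measurable_fun setT (fun x => ln (d x)).
  exact: (measurableT_comp (@measurable_ln R)).
apply: (prior_integral_le _ _ P `[1%R, +oo[%classic (risk (fun x => ln (d x)))
  (fun m => powR (ln m) p) S lam (powR eta p)) => //.
- exact: measurable_risk_ge1.
- by apply: measurable_funTS; exact: measurable_ln_moment.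
- move=> m; rewrite /= in_itv/= andbT => m1; apply: risk_ge0.
  exact: lt_le_trans m1.
- by move=> m _; exact: powR_ge0.
- exact: powR_ge0.
- by move=> m; rewrite /= in_itv/= andbT; exact: H.
Qed.

Lemma univ_prior_of_finite p eta F : finite_prior_class p eta F ->
  exists2 P : probability R R, univ_prior_class p eta P &
    forall d : R -> R, measurable_fun setT d ->
      univ_bayes_risk P d = bayes F (fun x => ln (d x)).
Proof.
move=> [F0 F1 Fc].
have [P HP] := finite_prior _ _ F (fun q qF => (F0 q qF).1) F1.
have FD q : q \in F -> `[1%R, +oo[%classic q.2.
  by move=> /F0[_ q1]; rewrite /= in_itv/= q1.
exists P => [|d md].
  split; first exact: (finite_prior_set _ _ F P _ F1 _ FD HP).
  rewrite HP//; last 2 first.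
  - apply/measurable_EFinP; apply: measurable_funTS; exact: measurable_ln_moment.
  - by move=> m _; rewrite lee_fin powR_ge0.
  by under eq_bigr do rewrite -EFinM; rewrite sumEFin lee_fin.
rewrite /univ_bayes_risk (HP _ (risk (fun x => ln (d x))))//.
- apply: measurable_risk_ge1; exact: (measurableT_comp (@measurable_ln R)).
- move=> m; rewrite /= in_itv/= andbT => m1; apply: risk_ge0.
  exact: lt_le_trans m1.
Qed.

(** * Multivariate Bayes risks *)

Lemma measurable_support_ge1 n : measurable (@support_ge1 R n).
Proof.
rewrite (_ : support_ge1 n = \bigcap_(i in [set: 'I_n])
    ((fun mu : n.-tuple R => tnth mu i) @^-1` `[1%R, +oo[%classic)).
  apply: fin_bigcap_measurable; first exact: finite_finset.
  move=> i _; rewrite -[X in measurable X]setTI.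
  exact: measurable_tnth.
apply/seteqP; split => mu /= H i.
  by move=> _; rewrite /= in_itv/= H.
by have := H i Logic.I; rewrite /= in_itv/= andbT.
Qed.

Lemma log_lossE n (est mu : n.-tuple R) :
  ((log_loss n est mu)%:E = \sum_(i < n) (n%:R^-1)%:E *
    ((ln (tnth est i) - ln (tnth mu i)) ^+ 2)%:E)%E.
Proof. by rewrite /log_loss mulr_sumr -sumEFin. Qed.

Lemma measurable_log_loss n (d : n.-tuple R -> n.-tuple R) :
  measurable_fun setT d ->
  measurable_fun setT (fun z : n.-tuple R * n.-tuple R => (log_loss n (d z.2) z.1)%:E).
Proof.
move=> md; apply/measurable_EFinP; apply: measurable_funM => //.
apply: measurable_sum => i; apply: measurable_funX; apply: measurable_funB.
  apply: (measurableT_comp (@measurable_ln R)).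
  apply: (measurableT_comp (@measurable_tnth _ R n i)).
  exact: (measurableT_comp md).
apply: (measurableT_comp (@measurable_ln R)).
exact: (measurableT_comp (@measurable_tnth _ R n i)).
Qed.

Lemma log_loss_ge0 n (est mu : n.-tuple R) : 0 <= log_loss n est mu.
Proof.
by rewrite mulr_ge0 ?invr_ge0//; apply: sumr_ge0 => i _; exact: sqr_ge0.
Qed.

Lemma measurable_cond_risk n (d : n.-tuple R -> n.-tuple R) :
  measurable_fun setT d ->
  measurable_fun (support_ge1 n)
    (fun mu => cond_expect n mu (fun x => (log_loss n (d x) mu)%:E)).
Proof.
move=> md.
(* Clipping keeps the means of the densities positive off the support; the loss retains the original
   [mu]. *)
pose clip (mu : n.-tuple R) := map_tuple (Num.max 1) mu.
have mclip : measurable_fun setT clip.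
  apply/measurable_fun_tnthP => i.
  rewrite (_ : _ \o _ = fun mu => Num.max 1 (tnth mu i)).
    by apply: measurable_maxr => //; exact: measurable_tnth.
  by apply/funext => mu /=; rewrite tnth_map.
apply: (eq_measurable_fun
  (fun mu => cond_expect n (clip mu) (fun x => (log_loss n (d x) mu)%:E))).
  move=> mu; rewrite inE => Hmu; congr cond_expect.
  apply: eq_from_tnth => i; rewrite tnth_map; apply/max_idPr.
  exact: Hmu.
apply: measurable_funTS.
apply: (measurable_cond_expect n clip (fun z => (log_loss n (d z.2) z.1)%:E)) => //.
- exact: measurable_log_loss.
- by move=> mu i; rewrite tnth_map lt_max ltr01.
- by move=> z; rewrite lee_fin log_loss_ge0.
Qed.

Lemma cond_expect_log_loss n (mu : n.-tuple R) (d : n.-tuple R -> n.-tuple R) :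
  (forall i, 0 < tnth mu i) -> measurable_fun setT d ->
  (cond_expect n mu (fun x => (log_loss n (d x) mu)%:E) =
   \sum_(i < n) (n%:R^-1)%:E * cond_expect n mu
     (fun x => ((ln (tnth (d x) i) - ln (tnth mu i)) ^+ 2)%:E))%E.
Proof.
move=> mu0 md.
rewrite -(cond_expect_sum n mu _ _ (fun=> n%:R^-1) (fun i x =>
  ((ln (tnth (d x) i) - ln (tnth mu i)) ^+ 2)%:E))//.
- by congr cond_expect; apply/funext => x; exact: log_lossE.
- move=> i _; apply/measurable_EFinP; apply: measurable_funX; apply: measurable_funB => //.
  apply: (measurableT_comp (@measurable_ln R)).
  exact: (measurableT_comp (@measurable_tnth _ R n i)).
- by move=> i x _; rewrite lee_fin sqr_ge0.
Qed.

Definition separable_estimator n (d : R -> R) (x : n.-tuple R) : n.-tuple R :=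
  map_tuple d x.

Lemma cond_risk_separable n (d : R -> R) (mu : n.-tuple R) :
  (forall i, 0 < tnth mu i) -> measurable_fun setT d ->
  (cond_expect n mu (fun x => (log_loss n (separable_estimator n d x) mu)%:E) =
   \sum_(i < n) (n%:R^-1)%:E * risk (fun x => ln (d x)) (tnth mu i))%E.
Proof.
move=> mu0 md; rewrite cond_expect_log_loss//; last first.
  apply/measurable_fun_tnthP => i.
  rewrite (_ : _ \o _ = fun x => d (tnth x i)); last first.
    by apply/funext => x /=; rewrite tnth_map.
  exact: (measurableT_comp md (@measurable_tnth _ R n i)).
apply: eq_bigr => i _; congr (_ * _)%E.
transitivity (cond_expect n mu (fun x => ((ln (d (tnth x i)) - ln (tnth mu i)) ^+ 2)%:E)).
  by congr cond_expect; apply/funext => x; rewrite tnth_map.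
apply: (cond_expect_tnth n mu i (fun x => ((ln (d x) - ln (tnth mu i)) ^+ 2)%:E)) => //.
- apply/measurable_EFinP; apply: measurable_funX; apply: measurable_funB => //.
  exact: (measurableT_comp (@measurable_ln R)).
- by move=> x; rewrite lee_fin sqr_ge0.
Qed.

Lemma measurable_separable_estimator n (d : R -> R) : measurable_fun setT d ->
  measurable_fun setT (separable_estimator n d).
Proof.
move=> md; apply/measurable_fun_tnthP => i.
rewrite (_ : _ \o _ = fun x => d (tnth x i)); last first.
  by apply/funext => x /=; rewrite tnth_map.
exact: (measurableT_comp md (@measurable_tnth _ R n i)).
Qed.

Lemma support_ge1_gt0 n (mu : n.-tuple R) : support_ge1 n mu -> forall i, 0 < tnth mu i.
Proof. by move=> H i; exact: lt_le_trans (H i). Qed.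

Lemma cond_risk_ge0 n (mu : n.-tuple R) (d : n.-tuple R -> n.-tuple R) :
  support_ge1 n mu -> (0 <= cond_expect n mu (fun x => (log_loss n (d x) mu)%:E))%E.
Proof.
move=> H; apply: cond_expect_ge0; first exact: support_ge1_gt0.
by move=> x; rewrite lee_fin log_loss_ge0.
Qed.

Lemma measurable_ln_moment_mean n p : measurable_fun setT
  (fun mu : n.-tuple R => n%:R^-1 * \sum_(i < n) powR (ln (tnth mu i)) p).
Proof.
apply: measurable_funM => //; apply: measurable_sum => i.
exact: (measurableT_comp (measurable_ln_moment p) (@measurable_tnth _ R n i)).
Qed.

Lemma ln_moment_mean_ge0 n p (mu : n.-tuple R) :
  0 <= n%:R^-1 * \sum_(i < n) powR (ln (tnth mu i)) p.
Proof. by rewrite mulr_ge0 ?invr_ge0//; apply: sumr_ge0 => i _; exact: powR_ge0. Qed.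

(** The line bounds are averaged over the coordinates, which produces exactly the moment constrained
    by the class. Dependence between coordinates of the prior is harmless, since each term involves
    one coordinate. *)
Lemma bayes_risk_separable_le n p eta S lam (d : R -> R)
    (pi : probability (n.-tuple R) R) : (0 < n)%N ->
  0 <= S -> 0 <= lam -> measurable_fun setT d ->
  (forall m, 1 <= m -> (risk (fun x => ln (d x)) m + (lam * powR eta p)%:E <=
    (S + lam * powR (ln m) p)%:E)%E) ->
  prior_class n p eta pi -> (bayes_risk n pi (separable_estimator n d) <= S%:E)%E.
Proof.
move=> n0 S0 lam0 md H [piD pic].
have nN : n%:R != 0 :> R by rewrite pnatr_eq0 -lt0n.
have md' := measurable_separable_estimator n d md.
apply: (prior_integral_le _ _ pi (support_ge1 n)
  (fun mu => cond_expect n mu (fun x => (log_loss n (separable_estimator n d x) mu)%:E))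
  (fun mu => n%:R^-1 * \sum_(i < n) powR (ln (tnth mu i)) p) S lam (powR eta p)) => //.
- exact: measurable_support_ge1.
- exact: measurable_cond_risk.
- by apply: measurable_funTS; exact: measurable_ln_moment_mean.
- by move=> mu; exact: cond_risk_ge0.
- by move=> mu _; exact: ln_moment_mean_ge0.
- exact: powR_ge0.
- move=> mu Hmu; rewrite cond_risk_separable//; last exact: support_ge1_gt0.
  have /choice[r Hr] : forall i, exists r, risk (fun x => ln (d x)) (tnth mu i) = r%:E.
    move=> i; have := H _ (Hmu i).
    have := risk_ge0 (fun x => ln (d x)) _ (support_ge1_gt0 n mu Hmu i).
    by case: (risk _ _) => [r| |]//; exists r.
  under eq_bigr do rewrite Hr -EFinM.
  rewrite sumEFin -EFinD lee_fin.
  have : \sum_(i < n) (r i + lam * powR eta p) <=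
      \sum_(i < n) (S + lam * powR (ln (tnth mu i)) p).
    by apply: ler_sum => i _; have := H _ (Hmu i); rewrite Hr -EFinD lee_fin.
  rewrite !big_split /= !sumr_const card_ord -!mulr_sumr.
  set A := \sum_(i < n) r i; set B := \sum_(i < n) powR _ p.
  have nE (x : R) : x = n%:R * (n%:R^-1 * x) by rewrite mulrA mulfV// mul1r.
  rewrite {1}(nE A) {1}(nE B); move: (n%:R^-1 * A) (n%:R^-1 * B) => A' B'.
  rewrite -(mulr_natl (lam * _)) -(mulr_natl S) => le1.
  have nR : 0 < n%:R :> R by rewrite ltr0n.
  by rewrite -(ler_pM2l nR); lra.
Qed.

Lemma prior_of_product n p eta F : (0 < n)%N -> finite_prior_class p eta F ->
  exists2 pi : probability (n.-tuple R) R, prior_class n p eta pi &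
    forall d : n.-tuple R -> n.-tuple R, measurable_fun setT d ->
      (bayes_risk n pi d = \sum_(z <- product_prior F n)
        z.1%:E * cond_expect n z.2 (fun x => (log_loss n (d x) z.2)%:E))%E.
Proof.
move=> n0 [F0 F1 Fc].
have nN : n%:R != 0 :> R by rewrite pnatr_eq0 -lt0n.
pose L := product_prior F n.
have L0 := product_prior_ge0 F n (fun q qF => (F0 q qF).1).
have L1 := product_prior_sum1 F n F1.
have LD := product_prior_all (fun m => 1 <= m) F n (fun q qF => (F0 q qF).2).
have [pi Hpi] := finite_prior _ _ L L0 L1.
exists pi => [|d md].
  split; first exact: (finite_prior_set _ _ L pi _ L1 (measurable_support_ge1 n) LD Hpi).
  rewrite Hpi//; last 3 first.
  - exact: measurable_support_ge1.
  - by apply/measurable_EFinP; apply: measurable_funTS; exact: measurable_ln_moment_mean.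
  - by move=> mu _; rewrite lee_fin ln_moment_mean_ge0.
  under eq_bigr do rewrite -EFinM mulrCA mulr_sumr.
  rewrite sumEFin lee_fin -mulr_sumr exchange_big /=.
  under eq_bigr => i _ do rewrite (product_prior_marginal F n (fun m => powR (ln m) p))//.
  by rewrite sumr_const card_ord -[X in _ * X <= _]mulr_natl mulrA mulVf// mul1r.
rewrite /bayes_risk Hpi//.
- exact: measurable_support_ge1.
- exact: measurable_cond_risk.
- by move=> mu; exact: cond_risk_ge0.
Qed.

(** By contradiction: if every univariate Bayes risk exceeded [W + e], each coordinate of [d] would
    have risk at least [W + e] under the product prior, and so would their average, which is at most
    [W]. *)
Lemma exists_bayes_le n p eta W F (d : n.-tuple R -> n.-tuple R) : (0 < n)%N ->
  finite_prior_class p eta F -> measurable_fun setT d -> 0 <= W ->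
  (forall pi, prior_class n p eta pi -> (bayes_risk n pi d <= W%:E)%E) ->
  forall e, 0 < e -> exists2 g : R -> R, measurable_fun setT g &
    (bayes F g <= (W + e)%:E)%E.
Proof.
move=> n0 Fc md W0 HW e e0.
have [pi pic piE] := prior_of_product n p eta F n0 Fc.
have [F0 F1 _] := Fc.
have nN : n%:R != 0 :> R by rewrite pnatr_eq0 -lt0n.
have := HW _ pic; rewrite piE// => le1.
apply: contrapT => Hn.
have HF (g : R -> R) : measurable_fun setT g -> ((W + e)%:E <= bayes F g)%E.
  move=> mg; rewrite leNgt; apply/negP => lt1; apply: Hn.
  by exists g => //; exact: ltW.
have Fpos q : q \in F -> 0 < q.2 by move=> /F0[_]; exact: lt_le_trans.
have Lpos := product_prior_all (fun m => 0 < m) F n Fpos.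
have L0 := product_prior_ge0 F n (fun q qF => (F0 q qF).1).
have We0 : 0 <= W + e by rewrite addr_ge0// ltW.
have LE i : ((W + e)%:E <= \sum_(z <- product_prior F n) z.1%:E *
     cond_expect n z.2 (fun x => ((ln (tnth (d x) i) - ln (tnth z.2 i)) ^+ 2)%:E))%E.
  apply: (product_prior_risk_ge F n (W + e) i (fun x => ln (tnth (d x) i))) => //.
    by move=> q /F0[].
  apply: (measurableT_comp (@measurable_ln R)).
  exact: (measurableT_comp (@measurable_tnth _ R n i)).
have : ((W + e)%:E <= W%:E)%E; last by rewrite lee_fin; lra.
apply: le_trans le1.
rewrite [leRHS](_ : _ = \sum_(i < n) (n%:R^-1)%:E * \sum_(z <- product_prior F n) z.1%:E *
     cond_expect n z.2 (fun x => ((ln (tnth (d x) i) - ln (tnth z.2 i)) ^+ 2)%:E))%E.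
  apply: (@le_trans _ _ (\sum_(i < n) (n%:R^-1)%:E * (W + e)%:E)%E).
    under eq_bigr do rewrite -EFinM.
    by rewrite sumEFin sumr_const card_ord -[_ * _ *+ n]mulr_natl mulrA mulfV// mul1r.
  by apply: lee_sum => i _; apply: lee_wpmul2l; [rewrite lee_fin invr_ge0|exact: LE].
have ce0 z (i : 'I_n) : z \in product_prior F n -> (0 <= cond_expect n z.2
    (fun x => ((ln (tnth (d x) i) - ln (tnth z.2 i)) ^+ 2)%:E))%E.
  move=> zL; apply: cond_expect_ge0; first exact: Lpos.
  by move=> x; rewrite lee_fin sqr_ge0.
transitivity (\sum_(z <- product_prior F n) \sum_(i < n) (n%:R^-1)%:E * (z.1%:E *
     cond_expect n z.2 (fun x => ((ln (tnth (d x) i) - ln (tnth z.2 i)) ^+ 2)%:E)))%E.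
  rewrite big_seq [RHS]big_seq; apply: eq_bigr => z zL.
  rewrite cond_expect_log_loss//; last exact: Lpos.
  rewrite ge0_sume_distrr; first by apply: eq_bigr => i _; rewrite muleCA.
  by move=> i _; apply: mule_ge0; [rewrite lee_fin invr_ge0|exact: ce0].
rewrite exchange_big; apply: eq_bigr => i _.
rewrite big_seq [in RHS]big_seq ge0_sume_distrr// => z zL.
by apply: mule_ge0; [rewrite lee_fin L0|exact: ce0].
Qed.

End Risks.

(** * Equality of the two minimax risks *)

Theorem theorem2p2 (R : realType) (p eta : R) (n : nat) :
  0 < p -> p < 2 -> 0 < eta -> (0 < n)%N ->
  minimax_bayes_risk n p eta = univ_minimax_bayes_risk p eta.
Proof.
move=> p0 _ eta0 n0.
pose D1 : seq (R * R) := [:: (1, 1)].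
have D1c : finite_prior_class p eta D1.
  by apply: finite_prior_class_point => //; rewrite ln1 powR0 ?gt_eqF// powR_ge0.
apply/eqP; rewrite eq_le; apply/andP; split.
- apply: le_ereal_inf_tmp => _ [d [[md d0] ->]].
  set S := ereal_sup _.
  have SP P : univ_prior_class p eta P -> (univ_bayes_risk P d <= S)%E.
    by move=> HP; apply: ereal_sup_ubound; exists P.
  have SF F : finite_prior_class p eta F -> (bayes F (fun x => ln (d x)) <= S)%E.
    by move=> /univ_prior_of_finite[P HP <-//]; exact: SP.
  have S0 : (0 <= S)%E.
    apply: le_trans (SF _ D1c); apply: bayes_ge0; by case: D1c.
  (* An estimator of infinite worst-case risk gives a trivial bound; otherwise [S] is real and has a
     supporting line. *)
  clearbody S; case: S S0 SP SF => [S| |]//; last by move=> *; exact: leey.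
  rewrite lee_fin => S0 SP SF.
  have [lam lam0 H] := risk_affine_majorant p eta S _ p0 eta0 SF.
  apply: ge_ereal_inf; exists (ereal_sup [set bayes_risk n pi (separable_estimator n d)
      | pi in prior_class n p eta]).
    exists (separable_estimator n d); split => //; split.
      exact: measurable_separable_estimator.
    by move=> x i; rewrite tnth_map.
  apply: ge_ereal_sup => _ [pi Hpi <-].
  exact: (bayes_risk_separable_le n p eta S lam).
- apply: le_ereal_inf_tmp => _ [d [[md d0] ->]].
  set W := ereal_sup _.
  have WP pi : prior_class n p eta pi -> (bayes_risk n pi d <= W)%E.
    by move=> Hpi; apply: ereal_sup_ubound; exists pi.
  have W0 : (0 <= W)%E.
    have [pi Hpi _] := prior_of_product n p eta D1 n0 D1c.
    apply: le_trans (WP _ Hpi); apply: integral_ge0 => mu Hmu.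
    exact: cond_risk_ge0.
  clearbody W; case: W W0 WP => [W| |]//; last by move=> *; exact: leey.
  rewrite lee_fin => W0 WP.
  apply/lee_addgt0Pr => e e0; rewrite -EFinD.
  pose e2 := e / 2; have e20 : 0 < e2 by rewrite divr_gt0.
  (* Chosen so that [(1 - s) * (W + e) = W + e2]: dividing the perturbed bound by [1 - s] gives
     exactly [W + e]. *)
  pose s := e2 / (W + e).
  have We : 0 < W + e by rewrite ltr_wpDl.
  have s0 : 0 < s by rewrite divr_gt0.
  have s1 : s < 1 by rewrite /s ltr_pdivrMr// /e2; lra.
  have [g mg Hg] := finite_minimax p eta (W + e2) s p0 s0 s1
    (fun F Fc => exists_bayes_le n p eta W F d n0 Fc md W0 WP e2 e20).
  have gF F : finite_prior_class p eta F -> (bayes F g <= (W + e)%:E)%E.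
    move=> Fc; have [F0 _ _] := Fc.
    have [a [b [-> _ a0 b0 ab]]] := ereal_convex_le _ _ _ _ s0 s1
      (bayes_ge0 F g F0) (risk_ge0 g 1 ltr01) (Hg F Fc).
    rewrite lee_fin.
    have s10 : 0 < 1 - s by rewrite subr_gt0.
    rewrite -(ler_pM2l s10).
    (* The contribution of the mass at 1 is nonnegative and can be discarded. *)
    have sb : 0 <= s * b by rewrite mulr_ge0// ltW.
    have -> : (1 - s) * (W + e) = W + e2.
      by rewrite /s /e2; field; rewrite gt_eqF.
    lra.
  have [lam lam0 H] := risk_affine_majorant p eta (W + e) g p0 eta0 gF.
  (* Exponentiating returns from the logarithmic scale to a positive estimator. *)
  pose de x := expR (g x).
  have mde : measurable_fun setT de by exact: (measurableT_comp (@measurable_expR R)).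
  have gE : (fun x => ln (de x)) = g by apply/funext => x; rewrite /de expRK.
  apply: ge_ereal_inf; exists (ereal_sup [set univ_bayes_risk F de
      | F in univ_prior_class p eta]).
    by exists de; split => //; split => // x; exact: expR_gt0.
  apply: ge_ereal_sup => _ [P HP <-].
  apply: (univ_bayes_risk_le p eta (W + e) lam) => //; first exact: ltW.
  by rewrite gE.
Qed.
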